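(* Let $\Delta\Pi=\delta_1X_1+\cdots+\delta_nX_n$, where $X=(X_1,\ldots,X_n)$ is a mixture of $m$ Student-$t$ distributions, with density $$h_X(x)=\sum_{j=1}^m\beta_j\,\frac{\Gamma\left(\frac{\nu_j+n}{2}\right)}{\Gamma(\nu_j/2)\sqrt{|\Sigma_j|(\nu_j\pi)^n}}\left(1+\frac{(x-\mu_j)\Sigma_j^{-1}(x-\mu_j)^t}{\nu_j}\right)^{\frac{-\nu_j-n}{2}},\qquad x\in\mathbb{R}^n,\ \nu_j>2,$$ where $\mu_j$ is the vector mean and $\Sigma_j$ the variance-covariance matrix of the $j$-th component of the mixture. Then the Value-at-Risk, or Delta mixture-Student VaR, at confidence $1-\alpha$ is given as the solution $VaR_\alpha$ of the transcendental equation $$\alpha=\sum_{j=1}^m\frac{\beta_j\,\Gamma\left(\frac{\nu_j+1}{2}\right)}{\nu_j\sqrt{\pi}\,\Gamma\left(\frac{\nu_j}{2}\right)}\,\nu_j^{\frac{\nu_j}{2}}\left(\frac{\delta\cdot\mu_j^t+VaR_\alpha}{\delta\Sigma_j\delta^t}\right)^{-\frac{\nu_j}{2}}{}_2F_1\left(\frac{1+\nu_j}{2},\frac{\nu_j}{2};1+\frac{\nu_j}{2};-\frac{\nu_j(\delta\cdot\mu_j^t+VaR_\alpha)}{\delta\Sigma_j\delta^t}\right).$$ Here $\delta=(\delta_1,\ldots,\delta_n)$. The statement is accompanied by the notation (not occurring in the displayed equation) $$G_j(s)=\frac{\nu_j^{\frac{n+\nu_j}{2}}}{2}\,|S_{n-2}|\,C(\nu_j,n)\int_s^\infty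 I_j(z_1)\,dz_1,\qquad I_j(z_1)=\int_{z_1^2}^{+\infty}(u-z_1^2)^{\frac{n-3}{2}}(\nu_j+u)^{-\frac{n+\nu_j}{2}}\,du,$$ which corresponds to $g=g_j$ with $g_j(s)=C(\nu_j,n)(1+s/\nu_j)^{-\frac{n+\nu_j}{2}}$, $s\ge0$.
   Context: Vectors such as $x,\delta,\mu_j$ are row vectors, $^t$ denotes transpose, and $\delta\cdot\mu_j^t$ denotes the inner product $\sum_i\delta_i(\mu_j)_i$. The weights satisfy $\beta_j>0$ and $\sum_{j=1}^m\beta_j=1$. $|\Sigma_j|$ is the determinant of $\Sigma_j$, $|S_{n-2}|$ is the surface measure of the unit sphere in $\mathbb{R}^{n-1}$, and $C(\nu_j,n)=\Gamma\left(\frac{\nu_j+n}{2}\right)/\left(\Gamma(\nu_j/2)\sqrt{(\nu_j\pi)^n}\right)$. $\Delta\Pi$ is the profit and loss of a linear portfolio over a fixed time window. Portfolio losses are recorded as negative numbers and the Value-at-Risk is stated as a positive quantity: $VaR_\alpha$ at confidence level $1-\alpha$ is defined by $\mathbb{P}(\Delta\Pi\le-VaR_\alpha)=\alpha$. ${}_2F_1$ is the Gauss hypergeometric function.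
   Formalization: The printed equation is false; the power base is corrected to q=(δ·μ_j+VaR)²/(δΣ_jδᵗ) and the 2F1 argument to −ν_j/q. VaR is restricted to δ·μ_j+VaR>0 for all j, δ≠0, and Σ_j is the positive definite matrix in the density, not the covariance. *)

(* Defs.v *)
From HB Require Import structures.
From mathcomp Require Import all_boot all_order all_algebra.
From mathcomp Require Import all_classical all_reals all_analysis.

Set Implicit Arguments.
Unset Strict Implicit.
Unset Printing Implicit Defensive.

Import Order.TTheory GRing.Theory Num.Theory.
Import numFieldNormedType.Exports.

Local Open Scope classical_set_scope.
Local Open Scope ring_scope.

(** * Lebesgue measure on R^n, points of R^n being n-tuples *)

Section product_step.
Local Open Scope ereal_scope.
Context (R : realType) (n : nat).
Variable mu : {sigma_finite_measure set (n.-tuple R) -> \bar R}.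

Definition cons_pair (p : R * n.-tuple R) : n.+1.-tuple R := cons_tuple p.1 p.2.

Lemma measurable_cons_pair : measurable_fun [set: R * n.-tuple R] cons_pair.
Proof. exact: (measurable_cons measurable_fst measurable_snd). Qed.

Definition uncons (t : n.+1.-tuple R) : R * n.-tuple R :=
  (tnth t ord0, [tuple of behead t]).

Lemma measurable_uncons : measurable_fun [set: n.+1.-tuple R] uncons.
Proof.
by apply/measurable_fun_pair; [exact: measurable_tnth|exact: measurable_behead].
Qed.

Lemma cons_pairK : cancel cons_pair uncons.
Proof. by move=> [x t]; congr pair; apply/val_inj. Qed.

Definition product_step : set (n.+1.-tuple R) -> \bar R :=
  pushforward (lebesgue_measure \x mu) cons_pair.

Let product_step0 : product_step set0 = 0.
Proof. by rewrite /product_step /pushforward preimage_set0 measure0. Qed.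

Let product_step_ge0 A : 0 <= product_step A.
Proof.
rewrite /product_step /pushforward; exact: measure_ge0.
Qed.

Let product_step_sigma_additive : semi_sigma_additive product_step.
Proof.
rewrite /product_step.
apply: (@measure_semi_sigma_additive _ _ _
  (pushforward (lebesgue_measure \x mu) cons_pair : {measure set _ -> \bar R})).
exact: measurable_cons_pair.
Qed.

HB.instance Definition _ := isMeasure.Build _ _ _ product_step
  product_step0 product_step_ge0 product_step_sigma_additive.

Let product_step_sigma_finite : sigma_finite setT product_step.
Proof.
have /sigma_finiteP[F [FT ndF Foo]] :=
  sigma_finiteT (@lebesgue_measure R : {sigma_finite_measure set _ -> \bar R}).
have /sigma_finiteP[G [GT ndG Goo]] := sigma_finiteT mu.
exists (fun i => uncons @^-1` (F i `*` G i)).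
  rewrite -preimage_bigcup (_ : \bigcup_i _ = setT) ?preimage_setT//.
  apply/seteqP; split=> // -[x t] _.
  have [i _ Fx] : (\bigcup_i F i) x by rewrite -FT.
  have [k _ Gt] : (\bigcup_i G i) t by rewrite -GT.
  exists (maxn i k) => //; split.
  - by move: x Fx; exact/subsetPset/ndF/leq_maxl.
  - by move: t Gt; exact/subsetPset/ndG/leq_maxr.
move=> i; have [mF Ffin] := Foo i; have [mG Gfin] := Goo i; split.
  rewrite -[X in measurable X]setTI; apply: measurable_uncons => //.
  exact: measurableX.
rewrite /product_step /pushforward (_ : _ @^-1` _ = F i `*` G i).
  by rewrite product_measure1E// lte_mul_pinfty// ge0_fin_numE.
by rewrite -comp_preimage (_ : _ \o _ = id)//; apply/funext => p; exact: cons_pairK.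
Qed.

HB.instance Definition _ := Measure_isSigmaFinite.Build _ _ _ product_step
  product_step_sigma_finite.

End product_step.

Fixpoint lebesgue_tuple (R : realType) (n : nat) :
    {sigma_finite_measure set (n.-tuple R) -> \bar R} :=
  match n with
  | 0 => dirac ([tuple] : 0.-tuple R)
  | k.+1 => product_step (lebesgue_tuple R k)
  end.

Lemma lebesgue_tuple_box (R : realType) (n : nat) (A : 'I_n -> set R) :
  (forall i, measurable (A i)) ->
  lebesgue_tuple R n [set t | forall i, A i (tnth t i)] =
  (\prod_(i < n) lebesgue_measure (A i))%E.
Proof.
elim: n A => [|n IHn] A mA.
  rewrite big_ord0 /= diracE mem_set//=; by case.
rewrite big_ord_recl -IHn; last by move=> i; exact: mA.
rewrite -product_measure1E.
- rewrite /= /product_step /pushforward.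
  congr (product_measure1 _ _ _); apply/seteqP; split=> -[x t] /=.
    move=> H; split=> [|i]; first exact: (H ord0).
    by have := H (lift ord0 i); rewrite tnthS.
  move=> [Hx Ht] i; case: (unliftP ord0 i) => [j ->|->]//=.
  by rewrite tnthS; exact: Ht.
- exact: mA.
- rewrite (_ : [set t | _] = \bigcap_(i in [set: 'I_n])
      ((fun t : n.-tuple R => tnth t i) @^-1` A (lift ord0 i))).
    apply: fin_bigcap_measurable => //= i _; rewrite -[X in measurable X]setTI.
    by apply: measurable_tnth => //; exact: mA.
  by apply/seteqP; split=> t /= H i => [_|]; exact: H.
Qed.

(** * Special functions *)

Definition Gamma (R : realType) (a : R) : R :=
  \int[lebesgue_measure]_(t in `]0, +oo[) (t `^ (a - 1) * expR (- t)).

Section hypergeometric.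
Variable R : realType.
Implicit Types (a b c x z : R) (D : set R) (F : R -> R).

Definition pochhammer a (k : nat) : R := \prod_(i < k) (a + i%:R).

Definition gauss_coef a b c (k : nat) : R :=
  pochhammer a k * pochhammer b k / (pochhammer c k * k`!%:R).

(** For open [D]: [F] is locally the sum of a power series. *)
Definition real_analytic_on D F :=
  forall x0, D x0 -> exists u : R^nat,
    \forall x \near x0, pseries u (x - x0) @ \oo --> F x.

Definition is_gauss_continuation a b c F :=
  real_analytic_on `]-oo, 1[ F /\
  forall z, `|z| < 1 -> pseries (gauss_coef a b c) z @ \oo --> F z.

(** The Gauss series converges only for [`|z| < 1]; elsewhere 2F1 is its
    analytic continuation, here along the real half-line ]-oo, 1[, where it is
    unique and agrees with the principal branch. The value is irrelevant for
    [z >= 1], and for [c] a nonpositive integer. *)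
Definition hyp2F1 a b c z : R :=
  xget 0 [set y | exists2 F, is_gauss_continuation a b c F & F z = y].

End hypergeometric.

(** * Student mixtures and Value-at-Risk *)

Section student_mixture.
Variable R : realType.

Definition rdot n (u v : 'rV[R]_n) : R := (u *m v^T) 0 0.

Definition qform n (A : 'M[R]_n) (u : 'rV[R]_n) : R := (u *m A *m u^T) 0 0.

Definition posdefmx n (A : 'M[R]_n) :=
  A^T = A /\ forall u : 'rV[R]_n, u != 0 -> 0 < qform A u.

Definition student_pdf n (nu : R) (mu : 'rV[R]_n) (Sigma : 'M[R]_n)
    (x : 'rV[R]_n) : R :=
  Gamma ((nu + n%:R) / 2) /
    (Gamma (nu / 2) * Num.sqrt (\det Sigma * (nu * pi) ^+ n)) *
  (1 + qform (invmx Sigma) (x - mu) / nu) `^ ((- nu - n%:R) / 2).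

Definition student_mixture_pdf n m (beta nu : 'I_m -> R)
    (mu : 'I_m -> 'rV[R]_n) (Sigma : 'I_m -> 'M[R]_n) (x : 'rV[R]_n) : R :=
  \sum_(j < m) beta j * student_pdf (nu j) (mu j) (Sigma j) x.

Definition has_density d (T : measurableType d) (P : probability T R) n
    (X : 'I_n -> {RV P >-> R}) (h : 'rV[R]_n -> R) :=
  forall A : set (n.-tuple R), measurable A ->
    P [set w | A [tuple X i w | i < n]] =
    (\int[lebesgue_tuple R n]_(t in A) (h (\row_i tnth t i))%:E)%E.

Definition linear_portfolio d (T : measurableType d) (P : probability T R) n
    (delta : 'rV[R]_n) (X : 'I_n -> {RV P >-> R}) (w : T) : R :=
  \sum_(i < n) delta 0 i * X i w.

Definition is_VaR d (T : measurableType d) (P : probability T R)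
    (Z : T -> R) (alpha v : R) :=
  P [set w | Z w <= - v] = alpha%:E.

(** With [q j = (delta . mu_j + v)^2 / (delta Sigma_j delta^t)]. The source
    prints [(delta . mu_j + v) / (delta Sigma_j delta^t)] for [q j] in the power
    and for [1 / q j] in the argument of 2F1. That equation is not invariant
    under [(delta, v) -> (c delta, c v)], contrary to the definition of VaR, and
    is false; the tail of the Student density gives the expression below. *)
Definition mixture_student_tail n m (delta : 'rV[R]_n) (beta nu : 'I_m -> R)
    (mu : 'I_m -> 'rV[R]_n) (Sigma : 'I_m -> 'M[R]_n) (v : R) : R :=
  \sum_(j < m)
    let q := (rdot delta (mu j) + v) ^+ 2 / qform (Sigma j) delta in
    beta j * Gamma ((nu j + 1) / 2) /
      (nu j * Num.sqrt pi * Gamma (nu j / 2)) *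
    nu j `^ (nu j / 2) * q `^ (- (nu j / 2)) *
    hyp2F1 ((1 + nu j) / 2) (nu j / 2) (1 + nu j / 2) (- (nu j / q)).

End student_mixture.

(* Main.v *)
(** Integrating the coordinates one at a time (complete the square and use
    [\int (1 + y^2)^(-p) dy = sqrt pi Gamma(p - 1/2) / Gamma(p)]), after replacing
    one of them by [y = delta . x], shows that [delta . X] is univariate Student
    when [X] is multivariate Student. Its tail is a rescaled Euler integral. By
    the binomial series and dominated convergence, Euler's integral is the sum
    of a power series around every [z0 < 1], so it continues the Gauss series;
    by the identity theorem it is the only continuation. Finally the mixture
    tail is strictly decreasing in [v], so its equation has one solution. *)
Require Import Defs.
From mathcomp Require Import all_boot all_order all_algebra.
From mathcomp Require Import all_classical all_reals all_analysis.
From mathcomp Require Import measurable_realfun ring lra.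

Set Implicit Arguments.
Unset Strict Implicit.
Unset Printing Implicit Defensive.

Import Order.TTheory GRing.Theory Num.Theory.
Import numFieldNormedType.Exports.

Local Open Scope classical_set_scope.
Local Open Scope ring_scope.

(** * One-dimensional integrals *)

(** A component's tail formula sees s = delta . mu_j + v only through s^2, so it is the lower tail
    only for s > 0, to the left of the component's centre; hence the positivity condition on the
    admissible values of VaR. There 2F1 is evaluated at -nu / q, which lies below -1 as soon as q <
    nu, outside the disc of the Gauss series; hence the work on continuation. Each coordinate
    integrated out lowers the exponent p by 1/2, so p = (nu + n) / 2 arrives at a = (nu + 1) / 2
    whatever n is. With b = nu / 2 this gives 2 a = 2 b + 1, exactly the relation under which the
    Student density on a half-line rescales to Euler's integrand. Only one-dimensional affine
    substitutions and Tonelli are used, no change of variables in R^n: Schur complements carry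
    positive definiteness and the determinant from one coordinate to the next. *)

Lemma pushforward_affine_itv (R : realType) (a b : R) (X : set R) : 0 < a -> ocitv X ->
  (lebesgue_measure ((fun x : R => (a * x + b)%R) @^-1` X) = a^-1%:E * lebesgue_measure X)%E.
Proof.
move=> a0 /ocitvP[->|[[x y] /= xy ->]].
  by rewrite preimage_set0 !measure0 mule0.
rewrite (_ : _ @^-1` _ = `](x - b) / a, (y - b) / a]%classic); last first.
  apply/seteqP; split => z /=; rewrite !in_itv /= ltr_pdivrMr// ler_pdivlMr//;
    by rewrite ltrBlDr lerBrDr (mulrC z).
rewrite !lebesgue_measure_itv /= !lte_fin ltr_pM2r ?invr_gt0// ltrD2r xy -!EFinB -EFinM.
by congr EFin; ring.
Qed.

(** Lebesgue measure is [a] times its pushforward under x -> a x + b, because the two agree on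
    half-open intervals, which determine it. *)
Lemma ge0_integral_affine_pos (R : realType) (a b : R) (f : R -> \bar R) : 0 < a ->
  measurable_fun [set: R] f -> (forall x, 0 <= f x)%E ->
  (\int[lebesgue_measure]_x f x = a%:E * \int[lebesgue_measure]_x f (a * x + b)%R)%E.
Proof.
move=> a0 mf f0.
pose phi : R -> measurableTypeR R := fun x => a * x + b.
have mphi : measurable_fun [set: R] phi.
  by apply: measurable_funD => //; exact: measurable_funM.
pose nu := (pushforward (@lebesgue_measure R) phi :
  {measure set (measurableTypeR R) -> \bar R}).
pose mu := mscale (NngNum (ltW a0)) (nu mphi).
have E A : measurable A -> lebesgue_measure A = mu A.
  apply: lebesgue_measure_unique => X oX.
  transitivity (a%:E * lebesgue_measure (phi @^-1` X))%E => //.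
  rewrite pushforward_affine_itv// muleA -EFinM.
  by rewrite divff ?gt_eqF// mul1e.
rewrite (eq_measure_integral mu); last by move=> A mA _; exact: E.
rewrite ge0_integral_mscale//=; congr (_ * _)%E.
by rewrite ge0_integral_pushforward// preimage_setT.
Qed.

Lemma measurable_powR_comp d (T : measurableType d) (R : realType) (D : set T)
    (f : T -> R) (p : R) :
  measurable_fun D f -> measurable_fun D (fun x => f x `^ p).
Proof. by move=> mf; exact: (measurableT_comp (measurable_powR p)). Qed.

(** Extended by 0 to the whole line, so that scaling and Tonelli apply without tracking domains. *)
Definition Gamma_integrand (R : realType) (p : R) : R -> R :=
  (fun t => t `^ (p - 1) * expR (- t)) \_ `]0, +oo[.

(** * The Gamma function and the one-dimensional Student integral *)

Section gamma.
Variable R : realType.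
Implicit Types (p r t y : R).
Local Notation mu := (@lebesgue_measure R).

Lemma Gamma_integrand_pos p t : 0 < t -> Gamma_integrand p t = t `^ (p - 1) * expR (- t).
Proof. by move=> t0; rewrite /Gamma_integrand patchE mem_set//= in_itv/= t0. Qed.

Lemma Gamma_integrand_npos p t : t <= 0 -> Gamma_integrand p t = 0.
Proof.
move=> t0; rewrite /Gamma_integrand patchE memNset//= in_itv/= andbT.
by apply/negP; rewrite -leNgt.
Qed.

Lemma Gamma_integrand_ge0 p t : 0 <= Gamma_integrand p t.
Proof.
case: (ltP 0 t) => t0; last by rewrite Gamma_integrand_npos.
by rewrite Gamma_integrand_pos// mulr_ge0 ?powR_ge0 ?expR_ge0.
Qed.

Lemma measurable_Gamma_integrand p : measurable_fun [set: R] (Gamma_integrand p).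
Proof.
apply/(measurable_restrict _ _) => //; apply: measurable_funTS.
apply: measurable_funM; first exact: measurable_powR.
by apply: measurableT_comp => //; exact: measurable_funN.
Qed.

(** The bound [1 <= p] suffices here: [nu > 2] keeps every argument of [Gamma]
    above 1. *)
Lemma Gamma_integrand_le p : 1 <= p -> exists2 C : R, 0 <= C &
  forall t, Gamma_integrand p t <= C * exponential_pdf 2^-1 t.
Proof.
(* This choice makes (p - 1) / c at most 1/2, so ln (t / c) <= t / c bounds t^(p-1) by a constant
   times exp (t / 2), which costs only half of the decay. The factor 2 in the witness below cancels
   the rate of [exponential_pdf]. *)
move=> p1; pose c : R := 2 * p; have c0 : 0 < c by rewrite /c; lra.
exists (2 * expR ((p - 1) * ln c)); first by rewrite mulr_ge0// expR_ge0.
move=> t; case: (ltP 0 t) => t0; last first.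
  by rewrite Gamma_integrand_npos// !mulr_ge0 ?expR_ge0// exponential_pdf_ge0// invr_ge0.
rewrite Gamma_integrand_pos// exponential_pdfE ?invr_ge0// ?(ltW t0)//.
rewrite /powR gt_eqF// mulrACA divff// mul1r -!expRD ler_expR.
have : ln (t / c) <= t / c by rewrite ltW// ln_sublinear// divr_gt0.
rewrite ln_div ?posrE// => lnt.
have : (p - 1) * (t / c) <= t / 2.
  by rewrite mulrA ler_pdivrMr// /c -mulrA; nra.
have : (p - 1) * (ln t - ln c) <= (p - 1) * (t / c) by rewrite ler_wpM2l// subr_ge0.
lra.
Qed.

Lemma integrable_Gamma_integrand p : 1 <= p -> mu.-integrable setT (EFin \o Gamma_integrand p).
Proof.
move=> p1; have [C C0 gC] := Gamma_integrand_le p1.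
apply: (le_integrable _ _ _ (@integrableZl _ _ _ mu _ _ C _
  (integrable_exponential_pdf (rate := 2^-1) _))) => //.
- by apply/measurable_EFinP; exact: measurable_Gamma_integrand.
- move=> t _ /=; rewrite lee_fin !ger0_norm ?Gamma_integrand_ge0//.
  by rewrite mulr_ge0// exponential_pdf_ge0// invr_ge0.
Qed.

Lemma GammaE p : Gamma p = \int[mu]_t Gamma_integrand p t.
Proof. by rewrite /Gamma Rintegral_mkcond. Qed.

Lemma integral_Gamma_integrand p : 1 <= p -> (\int[mu]_t (Gamma_integrand p t)%:E = (Gamma p)%:E)%E.
Proof.
move=> p1; rewrite GammaE /Rintegral fineK//.
exact: integrable_fin_num (integrable_Gamma_integrand p1).
Qed.

(** On [1, 2] the integrand is at least exp (-2), since t^(p-1) >= 1 there. *)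
Lemma Gamma_gt0 p : 1 <= p -> 0 < Gamma p.
Proof.
move=> p1; rewrite -lte_fin -integral_Gamma_integrand//.
apply: (@lt_le_trans _ _ (\int[mu]_(t in `[1%R, 2%R]) (expR (- 2))%:E)%E).
  rewrite integral_cst//= lebesgue_measure_itv/= lte_fin ltr1n -EFinB -EFinM lte_fin.
  by rewrite mulr_gt0 ?expR_gt0// subr_gt0 ltr1n.
rewrite integral_mkcond; apply: ge0_le_integral => //.
- by move=> t _; apply: erestrict_ge0 => u _; rewrite lee_fin expR_ge0.
- by apply/(measurable_restrictT _ _).1.
- by apply/measurable_EFinP; exact: measurable_Gamma_integrand.
move=> t _; rewrite patchE; case: ifPn => [|_]; last by rewrite lee_fin Gamma_integrand_ge0.
rewrite inE/= in_itv/= => /andP[t1 t2].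
have t0 : 0 < t by rewrite (lt_le_trans _ t1).
rewrite lee_fin Gamma_integrand_pos// -[leLHS]mul1r ler_pM ?expR_ge0//.
  by rewrite -[leLHS](powRr0 t) ler_powR// subr_ge0.
by rewrite ler_expR lerN2.
Qed.

Lemma integral_Gamma_integrand_scale p r : 1 <= p -> 0 < r ->
  (\int[mu]_t (Gamma_integrand p (r * t))%:E = (r^-1 * Gamma p)%:E)%E.
Proof.
move=> p1 r0; rewrite EFinM -integral_Gamma_integrand//.
rewrite (@ge0_integral_affine_pos _ r 0 (EFin \o Gamma_integrand p)) //=.
- rewrite muleA -EFinM mulVf ?gt_eqF// mul1e.
  by apply: eq_integral => t _; rewrite addr0.
- by apply/measurable_EFinP; exact: measurable_Gamma_integrand.
- by move=> t; rewrite lee_fin Gamma_integrand_ge0.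
Qed.

Lemma integral_gauss_scale t : 0 < t ->
  (\int[mu]_y (expR (- (t * y ^+ 2)))%:E = (Num.sqrt pi * t `^ (- 2^-1))%:E)%E.
Proof.
move=> t0; have st : 0 < Num.sqrt t by rewrite sqrtr_gt0.
rewrite mulrC EFinM -integralT_gauss.
rewrite (@ge0_integral_affine_pos _ (Num.sqrt t) 0 (EFin \o gauss_fun)) //=.
- rewrite muleA -EFinM powRN powR12_sqrt ?ltW// mulVf ?gt_eqF// mul1e.
  apply: eq_integral => y _; rewrite addr0 /gauss_fun exprMn sqr_sqrtr//.
  exact: ltW.
- by apply/measurable_EFinP; exact: measurable_gauss_fun.
- by move=> y; rewrite lee_fin gauss_fun_ge0.
Qed.

(** The Beta value B(1/2, p - 1/2). *)
Definition student_const p : R := Num.sqrt pi * Gamma (p - 2^-1) / Gamma p.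

(** The bound on [p] puts p - 1/2 in the range [1, +oo[ covered by the Gamma estimates above. *)
Lemma integral_student_kernel p : 3 / 2 <= p ->
  (\int[mu]_y ((1 + y ^+ 2) `^ (- p))%:E = (student_const p)%:E)%E.
Proof.
move=> p32; have p1 : 1 <= p by lra.
have G0 := Gamma_gt0 p1.
have r0 y : 0 < 1 + y ^+ 2 by rewrite ltr_pwDl// sqr_ge0.
pose h (z : R * R) := Gamma_integrand p z.1 * expR (- (z.1 * z.2 ^+ 2)).
have h0 z : 0 <= h z by rewrite mulr_ge0 ?Gamma_integrand_ge0 ?expR_ge0.
have mh : measurable_fun setT h.
  apply: measurable_funM.
    by apply: measurableT_comp; [exact: measurable_Gamma_integrand|exact: measurable_fst].
  apply: measurableT_comp => //; apply: measurable_funN; apply: measurable_funM => //.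
  exact: measurable_funX.
(* [(1 + y^2)^(-p)] is a mixture of the Gaussians [exp (- t y^2)] with Gamma
   distributed [t]; Tonelli reduces the claim to the Gauss integral. *)
transitivity (\int[mu]_y ((Gamma p)^-1%:E * \int[mu]_t (h (t, y))%:E))%E.
  apply: eq_integral => y _.
  (* Scaling t by 1 + y^2 turns the inner integral into [Gamma p]. The Jacobian supplies the
     remaining factor (1 + y^2)^(-1), for a total exponent of -p. *)
  have -> : (\int[mu]_t (h (t, y))%:E =
      \int[mu]_t (((1 + y ^+ 2) `^ (1 - p))%:E * (Gamma_integrand p ((1 + y ^+ 2) * t))%:E))%E.
    apply: eq_integral => t _; rewrite -EFinM; congr EFin; rewrite /h /=.
    have [t0|t0] := ltP 0 t; last first.
      by rewrite !Gamma_integrand_npos ?mul0r ?mulr0// pmulr_rle0.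
    rewrite !Gamma_integrand_pos ?mulr_gt0// powRM ?(ltW t0) ?(ltW (r0 y))//.
    rewrite !mulrA -powRD; last by rewrite (gt_eqF (r0 y)) implybT.
    rewrite addrA subrK subrr powRr0 mul1r -mulrA -expRD.
    by congr (_ * expR _); ring.
  rewrite ge0_integralZl//=.
  - rewrite integral_Gamma_integrand_scale// -!EFinM; congr EFin.
    rewrite mulrC !mulrA mulfK ?gt_eqF// -powR_inv1 ?ltW// -powRD.
      by congr (_ `^ _); ring.
    by rewrite (gt_eqF (r0 y)) implybT.
  - apply/measurable_EFinP; apply: measurableT_comp; first exact: measurable_Gamma_integrand.
    exact: measurable_funM.
  - by move=> t _; rewrite lee_fin Gamma_integrand_ge0.
  - by rewrite lee_fin powR_ge0.
rewrite ge0_integralZl//=; last first.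
- by rewrite lee_fin invr_ge0 ltW.
- by move=> y _; apply: integral_ge0 => t _; rewrite lee_fin.
- apply: (measurable_fun_fubini_tonelli_G (m1 := mu) (EFin \o h)) => //.
  by apply/measurable_EFinP.
rewrite -(fubini_tonelli (m1 := mu) (m2 := mu) (EFin \o h))//; last first.
  by apply/measurable_EFinP.
(* The Gauss integral contributes t^(-1/2), which shifts the Gamma parameter from p to p - 1/2. *)
transitivity ((Gamma p)^-1%:E * \int[mu]_t ((Num.sqrt pi)%:E * (Gamma_integrand (p - 2^-1) t)%:E))%E.
  congr (_ * _)%E; apply: eq_integral => t _ /=.
  have [t0|t0] := ltP 0 t; last first.
    rewrite Gamma_integrand_npos// mule0 integral0_eq// => y _.
    by rewrite /h /= Gamma_integrand_npos// mul0r.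
  rewrite /h /=; under eq_integral do rewrite EFinM.
  rewrite ge0_integralZl//=.
  - rewrite integral_gauss_scale// -!EFinM !Gamma_integrand_pos//; congr EFin.
    rewrite mulrCA; congr (_ * _); rewrite mulrAC -powRD.
      by congr (_ `^ _ * _); ring.
    by rewrite (gt_eqF t0) implybT.
  - apply/measurable_EFinP; apply: measurableT_comp => //.
    by apply: measurable_funN; apply: measurable_funM => //; exact: measurable_funX.
  - by rewrite lee_fin Gamma_integrand_ge0.
rewrite ge0_integralZl//=.
- by rewrite integral_Gamma_integrand ?lerBrDr; [rewrite -!EFinM mulrC|lra].
- by apply/measurable_EFinP; exact: measurable_Gamma_integrand.
- by move=> t _; rewrite lee_fin Gamma_integrand_ge0.
Qed.

Lemma student_const_gt0 p : 3 / 2 <= p -> 0 < student_const p.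
Proof.
move=> p32; rewrite divr_gt0 ?mulr_gt0 ?sqrtr_gt0 ?pi_gt0 ?Gamma_gt0//; lra.
Qed.

(** The substitution y -> sqrt (c / a) y + m factors out c^(-p), and its Jacobian gives back
    c^(1/2): this is the loss of 1/2 in the exponent for each coordinate integrated out. *)
Lemma integral_student_affine p c a m : 3 / 2 <= p -> 0 < c -> 0 < a ->
  (\int[mu]_y ((c + a * (y - m) ^+ 2) `^ (- p))%:E =
   (student_const p * (Num.sqrt a)^-1 * c `^ (2^-1 - p))%:E)%E.
Proof.
move=> p32 c0 a0; pose s := Num.sqrt (c / a).
have ca : 0 < c / a by rewrite divr_gt0.
have s0 : 0 < s by rewrite sqrtr_gt0.
have mf : measurable_fun [set: R] (fun y => (c + a * (y - m) ^+ 2) `^ (- p)).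
  apply: measurable_powR_comp.
  apply: measurable_funD => //; apply: measurable_funM => //.
  by apply: measurable_funX; exact: measurable_funB.
rewrite (@ge0_integral_affine_pos _ s m (fun y => ((c + a * (y - m) ^+ 2) `^ (- p))%:E))//=.
- transitivity (s%:E * \int[mu]_y ((c `^ (- p))%:E * ((1 + y ^+ 2) `^ (- p))%:E))%E.
    congr (_ * _)%E; apply: eq_integral => y _; rewrite -EFinM -powRM ?ltW//.
      congr ((_ `^ _)%:E); rewrite addrK exprMn sqr_sqrtr ?ltW//.
      by field; rewrite gt_eqF.
    by rewrite ltr_pwDl// sqr_ge0.
  rewrite ge0_integralZl//=.
  + rewrite integral_student_kernel// -!EFinM; congr EFin.
    rewrite /s sqrtrM ?ltW// sqrtrV ?ltW// -(powR12_sqrt (ltW c0)).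
    rewrite powRD; last by rewrite (gt_eqF c0) implybT.
    by ring.
  + apply/measurable_EFinP; apply: measurable_powR_comp.
    by apply: measurable_funD => //; exact: measurable_funX.
  + by move=> y _; rewrite lee_fin powR_ge0.
  + by rewrite lee_fin powR_ge0.
- exact/measurable_EFinP.
- by move=> y; rewrite lee_fin powR_ge0.
Qed.

End gamma.

(** Either sign is needed: the coefficient of the replaced coordinate in [delta] may be negative,
    and the lower tail is mapped to [1, +oo[ by a reversal of orientation. *)
Lemma ge0_integral_affine (R : realType) (a b : R) (f : R -> \bar R) : a != 0 ->
  measurable_fun [set: R] f -> (forall x, 0 <= f x)%E ->
  (\int[lebesgue_measure]_x f x = `|a|%:E * \int[lebesgue_measure]_x f (a * x + b)%R)%E.
Proof.
have refl (g : R -> \bar R) : measurable_fun [set: R] g -> (forall x, 0 <= g x)%E ->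
    (\int[lebesgue_measure]_x g x = \int[lebesgue_measure]_x g (- x)%R)%E.
  move=> mg g0; pose phi : R -> measurableTypeR R := -%R.
  have mphi : measurable_fun [set: R] phi by exact: measurable_funN.
  pose nu := (pushforward (@lebesgue_measure R) phi :
    {measure set (measurableTypeR R) -> \bar R}).
  rewrite (eq_measure_integral (nu mphi)).
    by rewrite ge0_integral_pushforward.
  by move=> A mA _; apply/esym/lebesgue_measureN.
move=> a0 mf f0; have [ap|an] := ltP 0 a.
  by rewrite ger0_norm ?ltW// (ge0_integral_affine_pos b ap).
have {}an : 0 < - a by rewrite oppr_gt0 lt_neqAle a0.
rewrite ler0_norm -?oppr_ge0 ?ltW// (ge0_integral_affine_pos b an)//; congr (_ * _)%E.
rewrite refl//; first by apply: eq_integral => x _; rewrite mulrNN.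
apply: measurableT_comp => //.
by apply: measurable_funD => //; exact: measurable_funM.
Qed.

(** * Quadratic forms *)

Section quadratic_forms.
Variable R : realType.
Implicit Types n : nat.

Lemma qform_mulmx m n (A : 'M[R]_n) (N : 'M[R]_(m, n)) (u : 'rV[R]_m) :
  qform A (u *m N) = qform (N *m A *m N^T) u.
Proof. by rewrite /qform trmx_mul !mulmxA. Qed.

Lemma rdotC n (u v : 'rV[R]_n) : rdot u v = rdot v u.
Proof. by rewrite /rdot !mxE; apply: eq_bigr => i _; rewrite !mxE mulrC. Qed.

Lemma rdotDr n (u v w : 'rV[R]_n) : rdot u (v + w) = rdot u v + rdot u w.
Proof. by rewrite /rdot linearD/= mulmxDr mxE. Qed.

Lemma rdotZr n (a : R) (u v : 'rV[R]_n) : rdot u (a *: v) = a * rdot u v.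
Proof. by rewrite /rdot linearZ/= -scalemxAr mxE. Qed.

Lemma rdotNr n (u v : 'rV[R]_n) : rdot u (- v) = - rdot u v.
Proof. by rewrite -scaleN1r rdotZr mulN1r. Qed.

Lemma rdot_row_mx n (a b : R) (u v : 'rV[R]_n) :
  rdot (row_mx a%:M u) (row_mx b%:M v) = a * b + rdot u v.
Proof.
by rewrite /rdot tr_row_mx mul_row_col tr_scalar_mx -scalar_mxM !mxE mulr1n.
Qed.

Lemma qformD n (A : 'M[R]_n) (u v : 'rV[R]_n) : A^T = A ->
  qform A (u + v) = qform A u + 2 * rdot (u *m A) v + qform A v.
Proof.
have mxD (X Y : 'M[R]_1) : (X + Y) 0 0 = X 0 0 + Y 0 0 by rewrite mxE.
move=> As; have vu : (v *m A *m u^T) 0 0 = (u *m A *m v^T) 0 0.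
  have tr11 (X : 'M[R]_1) : X 0 0 = X^T 0 0 by rewrite mxE.
  by rewrite [RHS]tr11 !trmx_mul trmxK As mulmxA.
rewrite /qform /rdot linearD/= mulmxDr !mulmxDl !mxD vu; ring.
Qed.

Lemma qformZ n (A : 'M[R]_n) (c : R) (u : 'rV[R]_n) :
  qform A (c *: u) = c ^+ 2 * qform A u.
Proof.
by rewrite /qform linearZ/= -!scalemxAl -scalemxAr !mxE mulrA expr2.
Qed.

Lemma posdefmx_qform_ge0 n (A : 'M[R]_n) (u : 'rV[R]_n) : posdefmx A -> 0 <= qform A u.
Proof.
move=> [_ pA]; have [->|/pA/ltW//] := eqVneq u 0.
by rewrite /qform !mul0mx mxE.
Qed.

Section schur.
Variables (n : nat) (a : R) (r : 'rV[R]_n) (B : 'M[R]_n).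
Let A : 'M[R]_(1 + n) := block_mx a%:M r r^T B.
Definition schur : 'M[R]_n := B - a^-1 *: (r^T *m r).

(** Completing the square in the first coordinate: the square is what a one-dimensional integral
    removes, the Schur complement is the form left on the other coordinates. *)
Lemma qform_schur (x : R) (u : 'rV[R]_n) : a != 0 ->
  qform A (row_mx x%:M u) = a * (x + a^-1 * rdot u r) ^+ 2 + qform schur u.
Proof.
move=> a0; rewrite /qform /schur /A mul_row_block tr_row_mx mul_row_col tr_scalar_mx.
have ur : u *m r^T = (rdot u r)%:M by rewrite [LHS]mx11_scalar.
have ru : r *m u^T = (rdot u r)%:M by rewrite rdotC [LHS]mx11_scalar.
rewrite mulmxBr mulmxBl -scalemxAr -scalemxAl mulmxA -(mulmxA _ r) ur ru.
rewrite mulmxDl [(x%:M *m r + _) *m _]mulmxDl -(mulmxA _ r) ru.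
rewrite [u *m B *m _]mx11_scalar -!scalar_mxM !mxE /= !mulr1n.
by field.
Qed.

Lemma det_schur : a != 0 -> \det A = a * \det schur.
Proof.
(* Column elimination: right multiplication by a unit upper triangular matrix clears [r] and leaves
   the Schur complement in the corner. *)
move=> a0; have := det_ublock (1%:M : 'M[R]_1) (- (a^-1 *: r)) (1%:M : 'M[R]_n).
rewrite !det1 mulr1 => U1.
rewrite -[LHS]mulr1 -U1 -det_mulmx mulmx_block !mulmx1 !mulmx0 !addr0.
rewrite mul_scalar_mx scalerN scalerA divff// scale1r addNr.
rewrite det_lblock det_scalar1; congr (_ * \det _).
by rewrite mulmxN -scalemxAr addrC.
Qed.

Lemma posdef_schur : posdefmx A -> 0 < a /\ posdefmx schur.
Proof.
move=> [As pA]; have a0 : 0 < a.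
  (* The form takes the value [a] at the first basis vector. *)
  have := pA (row_mx 1%:M 0); rewrite /qform mul_row_block tr_row_mx mul_row_col.
  rewrite !mul0mx !addr0 trmx0 mulmx0 addr0 trmx1 mulmx1 mul1mx mxE mulr1n; apply.
  by apply/eqP => /(congr1 lsubmx); rewrite row_mxKl linear0 => /matrixP/(_ 0 0);
    rewrite !mxE => /eqP; rewrite oner_eq0.
split => //; split.
  move: As; rewrite /A tr_block_mx => /eq_block_mx[_ _ _ Bs].
  by rewrite /schur linearB/= linearZ/= trmx_mul trmxK Bs.
move=> u u0; have := pA (row_mx (- (a^-1 * rdot u r))%:M u).
rewrite qform_schur ?gt_eqF// addNr expr0n mulr0 add0r; apply.
by apply: contra u0 => /eqP /(congr1 rsubmx); rewrite row_mxKr linear0 => ->.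
Qed.

End schur.

Lemma posdef_block n (A : 'M[R]_(1 + n)) : posdefmx A ->
  A = block_mx (A 0 0)%:M (ursubmx A) (ursubmx A)^T (drsubmx A).
Proof.
move=> [As _]; rewrite -[LHS]submxK; congr block_mx.
- by rewrite [LHS]mx11_scalar; congr (_%:M); rewrite !mxE; congr (A _ _); apply/val_inj.
- by rewrite trmx_ursub As.
Qed.

Lemma row_mx_eta n (u : 'rV[R]_(1 + n)) : u = row_mx (u 0 0)%:M (rsubmx u).
Proof.
rewrite -[LHS]hsubmxK; congr row_mx.
by rewrite [LHS]mx11_scalar; congr (_%:M); rewrite !mxE; congr (u _ _); apply/val_inj.
Qed.

Section hyperplane.
Variables (n : nat) (A : 'M[R]_(1 + n)) (d1 : R) (d' : 'rV[R]_n) (w : 'rV[R]_(1 + n)).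
Let delta : 'rV[R]_(1 + n) := row_mx d1%:M d'.
Hypotheses (Apos : posdefmx A) (d10 : d1 != 0) (wA : w *m A = delta).
(** Here [w] is delta A^-1, given by its equation rather than by an inverse, so [tau] is delta A^-1
    delta^t, the squared scale of delta . x. *)
Let tau := rdot delta w.
(** The identity block makes the coordinates of a vector of delta^⊥ in this basis its last [n]
    entries, which are the variables that remain once y = delta . x replaces the first one. *)
Definition hyperplane_basis : 'M[R]_(n, 1 + n) := row_mx (- (d1^-1 *: d'^T)) 1%:M.
Local Notation N := hyperplane_basis.
Let E := N *m A *m N^T.

Lemma hyperplane_basisP (k : 'rV[R]_(1 + n)) : rdot delta k = 0 ->
  k = rsubmx k *m N.
Proof.
move=> dk; rewrite mul_mx_row mulmx1 [LHS]row_mx_eta; congr row_mx.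
move: dk; rewrite [k in rdot _ k]row_mx_eta rdot_row_mx => dk.
rewrite mulmxN -scalemxAr [_ *m _]mx11_scalar -/(rdot _ _) rdotC scale_scalar_mx.
rewrite -raddfN/=; congr (_%:M); apply: (mulfI d10).
by rewrite mulrN mulVKf//; lra.
Qed.

Lemma posdef_hyperplane : posdefmx E.
Proof.
have [As pA] := Apos; split.
  by rewrite /E !trmx_mul trmxK As mulmxA.
move=> u u0; rewrite -qform_mulmx; apply: pA; apply: contra u0 => /eqP.
by rewrite mul_mx_row mulmx1 => /(congr1 rsubmx); rewrite row_mxKr linear0 => ->.
Qed.

Lemma qform_w : qform A w = tau.
Proof. by rewrite /qform wA. Qed.

Lemma tau_gt0 : 0 < tau.
Proof.
rewrite -qform_w; apply: (proj2 Apos); apply/eqP => w0.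
move: wA; rewrite w0 mul0mx => /(congr1 lsubmx); rewrite row_mxKl linear0.
by move=> /matrixP/(_ 0 0); rewrite !mxE mulr1n => /esym/eqP; apply/negP.
Qed.

(** [w] is [A]-orthogonal to the hyperplane [delta^⊥], which the rows of [N]
    span: split [u] into [(delta . u / tau) w] and its component in [delta^⊥]. *)
Lemma qform_hyperplane (u : 'rV[R]_(1 + n)) :
  qform A u = rdot delta u ^+ 2 / tau +
    qform E (rsubmx u - (rdot delta u / tau) *: rsubmx w).
Proof.
have t0 := gt_eqF tau_gt0; set s := rdot delta u.
pose k := u - (s / tau) *: w.
have dk : rdot delta k = 0.
  by rewrite /k rdotDr rdotNr rdotZr -/tau divfK ?t0// subrr.
have -> : rsubmx u - (s / tau) *: rsubmx w = rsubmx k.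
  by apply/rowP => i; rewrite !mxE.
rewrite -qform_mulmx -hyperplane_basisP//.
have -> : u = (s / tau) *: w + k by rewrite /k addrC subrK.
rewrite qformD; last by have [] := Apos.
rewrite qformZ qform_w -scalemxAl wA rdotC rdotZr rdotC dk !mulr0 addr0.
by congr (_ + _); field; rewrite t0.
Qed.

(** Compare the determinants of [A] and of [L A L^t], [L] having rows [w] and [N]. *)
Lemma det_hyperplane : d1 ^+ 2 * \det E = \det A * tau.
Proof.
have t0 := gt_eqF tau_gt0.
pose L : 'M[R]_(1 + n) := col_mx w N.
have detL : \det L = tau / d1.
  (* Column operations clear the left block of [N] and leave tau / d1 in the corner. *)
  have := det_lblock (1%:M : 'M[R]_1) (d1^-1 *: d'^T) (1%:M : 'M[R]_n).
  rewrite !det1 mulr1 => U1.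
  rewrite -[LHS]mulr1 -U1 -det_mulmx.
  rewrite /L (row_mx_eta w) /hyperplane_basis -block_mxEv mulmx_block !mulmx1 !mulmx0.
  rewrite mul1mx !add0r addNr det_ublock det1 mulr1 -scalemxAr.
  rewrite [_ *m d'^T]mx11_scalar -/(rdot _ _) scale_scalar_mx -raddfD/= det_scalar1.
  rewrite /tau [in RHS](row_mx_eta w) rdot_row_mx.
  by rewrite rdotC; field.
(* Since w A = delta is orthogonal to the rows of [N], the matrix L A L^t is block diagonal with
   blocks [tau] and [E]. *)
have wN : w *m A *m N^T = 0.
  rewrite wA /delta /hyperplane_basis tr_row_mx mul_row_col trmx1 mulmx1.
  rewrite linearN/= linearZ/= trmxK mulmxN mul_scalar_mx scalerA divff// scale1r.
  by rewrite addNr.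
have AsN : N *m A *m w^T = 0.
  apply: trmx_inj; rewrite trmx0 -wN !trmx_mul trmxK mulmxA.
  by have [-> _] := Apos.
have : \det (L *m A *m L^T) = tau * \det E.
  rewrite /L mul_col_mx tr_col_mx mul_col_row wN AsN.
  rewrite det_lblock [X in \det X * _]mx11_scalar det_scalar1.
  by rewrite -/(qform A w) qform_w.
rewrite !det_mulmx det_tr detL => H.
apply: (mulfI (negbT t0)); rewrite mulrCA -H.
by field.
Qed.

End hyperplane.
End quadratic_forms.

(** * Integrals over R^n *)

Definition tvec (R : realType) n (t : n.-tuple R) : 'rV[R]_n := \row_i tnth t i.

Section tuple_integrals.
Variable R : realType.
Implicit Types n : nat.
Local Notation mu := (@lebesgue_measure R).

Lemma tvec_cons n (x : R) (t : n.-tuple R) :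
  tvec (cons_pair (x, t)) = row_mx x%:M (tvec t) :> 'rV_(1 + n).
Proof.
apply/rowP => i; rewrite mxE -(splitK i); case: (fintype.split i) => [j|j] /=.
  by rewrite row_mxEl !ord1 mxE mulr1n (_ : lshift n 0 = ord0)//; exact/val_inj.
rewrite row_mxEr mxE (_ : rshift 1 j = lift ord0 j) ?tnthS//; exact/val_inj.
Qed.

Lemma measurable_tvec n i : measurable_fun [set: n.-tuple R] (fun t => tvec t 0 i).
Proof.
by rewrite (_ : (fun _ => _) = (fun t => tnth t i));
  [exact: measurable_tnth|apply/funext => t; rewrite mxE].
Qed.

Lemma measurable_rdot d (T : measurableType d) n (u : 'rV[R]_n) (f : T -> 'rV[R]_n) :
  (forall i, measurable_fun setT (fun z => f z 0 i)) ->
  measurable_fun setT (fun z => rdot u (f z)).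
Proof.
move=> mf; rewrite (_ : (fun _ => _) = (fun z => \sum_i u 0 i * f z 0 i)).
  by apply: measurable_sum => i; exact: measurable_funM.
by apply/funext => z; rewrite /rdot mxE; apply: eq_bigr => i _; rewrite mxE.
Qed.

Lemma measurable_qform d (T : measurableType d) n (A : 'M[R]_n) (f : T -> 'rV[R]_n) :
  (forall i, measurable_fun setT (fun z => f z 0 i)) ->
  measurable_fun setT (fun z => qform A (f z)).
Proof.
move=> mf; rewrite (_ : (fun _ => _) =
    (fun z => \sum_i (\sum_j f z 0 j * A j i) * f z 0 i)).
  apply: measurable_sum => i; apply: measurable_funM => //.
  by apply: measurable_sum => j; exact: measurable_funM.
by apply/funext => z; rewrite /qform mxE; apply: eq_bigr => i _; rewrite !mxE.
Qed.

Lemma ge0_integral_tuple0 (f : 0.-tuple R -> \bar R) :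
  measurable_fun setT f ->
  (\int[lebesgue_tuple R 0]_t f t = f [tuple])%E.
Proof. by move=> mf; rewrite /= integral_dirac// diracT mul1e. Qed.

(** The first coordinate is put innermost because the square is completed in it with all the others
    fixed. *)
Lemma ge0_integral_tupleS n (f : n.+1.-tuple R -> \bar R) :
  measurable_fun setT f -> (forall t, 0 <= f t)%E ->
  (\int[lebesgue_tuple R n.+1]_t f t =
   \int[lebesgue_tuple R n]_t \int[mu]_x f (cons_pair (x, t)))%E.
Proof.
move=> mf f0.
have mfc : measurable_fun setT (f \o @cons_pair R n).
  by apply: measurableT_comp => //; exact: measurable_cons_pair.
rewrite -(fubini_tonelli2 (m1 := mu) (m2 := lebesgue_tuple R n) (f \o @cons_pair R n))//=.
have := @ge0_integral_pushforward _ _ (measurableTypeR R * n.-tuple R)%type _ R _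
  (@measurable_cons_pair R n) (mu \x lebesgue_tuple R n)%E setT f measurableT mf
  (fun t _ => f0 t).
rewrite preimage_setT => <-.
by [].
Qed.

End tuple_integrals.

(** * Student integrals over R^n and their marginals *)

Section student_integrals.
Variable R : realType.
Implicit Types (n : nat) (c p : R).
Local Notation mu := (@lebesgue_measure R).

(** The constant [c] is left free: with y = delta . x fixed, the kernel in the remaining coordinates
    has c = 1 + (y - delta . m)^2 / tau. *)
Definition student_kernel n c p (A : 'M[R]_n) (m : 'rV[R]_n) (t : n.-tuple R) : R :=
  (c + qform A (tvec t - m)) `^ p.

Lemma measurable_student_kernel n c p A m :
  measurable_fun setT (@student_kernel n c p A m).
Proof.
apply: measurable_powR_comp; apply: measurable_funD => //.
apply: measurable_qform => i.
rewrite (_ : (fun _ => _) = (fun t => tvec t 0 i - m 0 i)).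
  by apply: measurable_funB => //; exact: measurable_tvec.
by apply/funext => t; rewrite !mxE.
Qed.

Lemma student_kernel_ge0 n c p A m t : 0 <= @student_kernel n c p A m t.
Proof. exact: powR_ge0. Qed.

Lemma behead_cons_pair n (x : R) (t : n.-tuple R) :
  [tuple of behead (cons_pair (x, t))] = t.
Proof. exact/val_inj. Qed.

(** The weight [h] does not see the first coordinate and passes through its integration. It serves
    as a constant for the total integral, and as a function of delta . x when [delta] starts with
    0. *)
Lemma integral_student_fst n c p (A : 'M[R]_(1 + n)) (m : 'rV[R]_(1 + n))
    (h : n.-tuple R -> R) :
  posdefmx A -> 0 < c -> 3 / 2 <= p -> measurable_fun setT h -> (forall t, 0 <= h t) ->
  (\int[lebesgue_tuple R n.+1]_t
     (h [tuple of behead t] * student_kernel c (- p) A m t)%:E =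
   (student_const p / Num.sqrt (A 0 0))%:E * \int[lebesgue_tuple R n]_t
     (h t * student_kernel c (2^-1 - p)
        (schur (A 0 0) (ursubmx A) (drsubmx A)) (rsubmx m) t)%:E)%E.
Proof.
move=> Apos c0 p32 mh h0; have EA := posdef_block Apos.
have [a0 Spos] : 0 < A 0 0 /\ posdefmx (schur (A 0 0) (ursubmx A) (drsubmx A)).
  by apply: posdef_schur; rewrite -EA.
have K0 : 0 <= student_const p / Num.sqrt (A 0 0).
  by rewrite divr_ge0 ?sqrtr_ge0// ltW// student_const_gt0.
rewrite ge0_integral_tupleS; last 2 first.
- apply/measurable_EFinP; apply: measurable_funM.
    by apply: measurableT_comp => //; exact: measurable_behead.
  exact: measurable_student_kernel.
- by move=> t; rewrite lee_fin mulr_ge0 ?student_kernel_ge0.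
rewrite -ge0_integralZl//; last 2 first.
- apply/measurable_EFinP; apply: measurable_funM => //.
  exact: measurable_student_kernel.
- by move=> t _; rewrite lee_fin mulr_ge0 ?student_kernel_ge0.
apply: eq_integral => t _.
set S := schur _ _ _; set a := A 0 0 in a0 K0 *; set r := ursubmx A.
pose v := tvec t - rsubmx m.
pose q := c + qform S v.
have q0 : 0 < q by rewrite ltr_pwDl// posdefmx_qform_ge0.
transitivity (\int[mu]_x ((h t)%:E *
    ((q + a * (x - (m 0 0 - a^-1 * rdot v r)) ^+ 2) `^ (- p))%:E))%E.
  apply: eq_integral => x _; rewrite -EFinM behead_cons_pair; congr ((_ * _ `^ _)%:E).
  rewrite tvec_cons [m in LHS]row_mx_eta opp_row_mx add_row_mx -raddfN -raddfD /=.
  rewrite [in LHS]EA qform_schur ?gt_eqF//.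
  by rewrite /q -/r -/v -/a -/S; ring.
rewrite ge0_integralZl//=.
- by rewrite integral_student_affine// -!EFinM /student_kernel -/S -/v -/q; congr EFin; ring.
- apply/measurable_EFinP; apply: measurable_powR_comp.
  apply: measurable_funD => //; apply: measurable_funM => //.
  by apply: measurable_funX; exact: measurable_funB.
- by move=> x _; rewrite lee_fin powR_ge0.
- by rewrite lee_fin.
Qed.

(** The integral of (1 + |t|^2)^(-p) over R^n, a product of [n] one-dimensional constants whose
    Gamma factors telescope. The bound (n + 2) / 2 <= p used with it says p - n / 2 >= 1. *)
Definition student_const_n n p : R :=
  Num.sqrt pi ^+ n * Gamma (p - n%:R / 2) / Gamma p.

Lemma student_const_n_gt0 n p : (n%:R + 2) / 2 <= p -> 0 < student_const_n n p.
Proof.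
move=> pn; have n0 : 0 <= n%:R :> R by [].
by rewrite divr_gt0 ?mulr_gt0 ?exprn_gt0 ?sqrtr_gt0 ?pi_gt0 ?Gamma_gt0//; lra.
Qed.

Lemma student_const_nS n p : 3 / 2 <= p ->
  student_const_n n.+1 p = student_const p * student_const_n n (p - 2^-1).
Proof.
move=> p32; rewrite /student_const_n /student_const.
have G0 : Gamma (p - 2^-1) != 0 by rewrite gt_eqF// Gamma_gt0//; lra.
have G1 : Gamma p != 0 by rewrite gt_eqF// Gamma_gt0//; lra.
rewrite (_ : p - n.+1%:R / 2 = p - 2^-1 - n%:R / 2); last by rewrite -natr1; field.
move: (Gamma p) (Gamma (p - 2^-1)) (Gamma _) G0 G1 => G1 G2 G3 G20 G10.
by rewrite exprS; field; rewrite G10 G20.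
Qed.

Lemma integral_student n c p (A : 'M[R]_n) (m : 'rV[R]_n) :
  posdefmx A -> 0 < c -> (n%:R + 2) / 2 <= p ->
  (\int[lebesgue_tuple R n]_t (student_kernel c (- p) A m t)%:E =
   (student_const_n n p / Num.sqrt (\det A) * c `^ (n%:R / 2 - p))%:E)%E.
Proof.
elim: n p A m => [|n IH] p A m Apos c0 pn.
  rewrite ge0_integral_tuple0; last first.
    by apply/measurable_EFinP; exact: measurable_student_kernel.
  rewrite /student_kernel [_ - m]thinmx0 /qform !mul0mx mxE addr0 det_mx00 sqrtr1 divr1.
  rewrite /student_const_n expr0 mul1r mul0r subr0 sub0r divff ?mul1r//.
  by rewrite gt_eqF// Gamma_gt0//; lra.
have n0 : 0 <= n%:R :> R by [].
move: pn; rewrite -natr1 => pn; have p32 : 3 / 2 <= p by lra.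
have EA := @posdef_block _ n A Apos.
pose S : 'M[R]_n := schur (A 0 0) (ursubmx (A : 'M[R]_(1 + n))) (drsubmx (A : 'M[R]_(1 + n))).
have [a0 Spos] : 0 < A 0 0 /\ posdefmx S by apply: posdef_schur; rewrite -EA.
have := @integral_student_fst n c p A m (cst 1) Apos c0 p32.
rewrite (eq_integral (fun t => (student_kernel c (- p) A m t)%:E)); last first.
  by move=> t _; rewrite mul1r.
move=> ->//; under eq_integral do rewrite mul1r -opprB.
rewrite IH//; last by lra.
rewrite student_const_nS// -EFinM [in RHS]EA det_schur ?gt_eqF// sqrtrM ?ltW// invfM.
congr EFin; rewrite (_ : n%:R / 2 - (p - 2^-1) = (n%:R + 1) / 2 - p); last by field.
by ring.
Qed.

Lemma rsubmx_tvec n (t : n.+1.-tuple R) :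
  rsubmx (tvec t : 'rV[R]_(1 + n)) = tvec [tuple of behead t].
Proof.
apply/rowP => i; rewrite !mxE tnth_behead; congr (tnth _ _).
by apply/val_inj; rewrite /= inordK// ltnS ltn_ord.
Qed.

Section marginal_step.
Variables (n : nat) (p : R) (A : 'M[R]_(1 + n)) (m w : 'rV[R]_(1 + n)).
Variables (d1 : R) (d' : 'rV[R]_n) (g : R -> R).
Let delta : 'rV[R]_(1 + n) := row_mx d1%:M d'.
Hypotheses (Apos : posdefmx A) (wA : w *m A = delta) (p32 : 3 / 2 <= p).
Hypotheses (mg : measurable_fun setT g) (g0 : forall y, 0 <= g y).
Let S : 'M[R]_n := schur (A 0 0) (ursubmx A) (drsubmx A).
Let tau := rdot delta w.

Lemma rdot_delta (u : 'rV[R]_(1 + n)) :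
  rdot delta u = d1 * u 0 0 + rdot d' (rsubmx u).
Proof. by rewrite [u in LHS]row_mx_eta rdot_row_mx. Qed.

(** The first entry of w A = delta expresses the first coordinate of [w] through the others;
    substituting it in the remaining entries gives the same equation for the Schur complement. As
    [delta] starts with 0, delta . w does not change either, so the induction keeps its scale. *)
Lemma marginal_schurM : d1 = 0 -> rsubmx w *m S = d'.
Proof.
move=> d10; have EA := posdef_block Apos.
have [a0 _] : 0 < A 0 0 /\ posdefmx S by apply: posdef_schur; rewrite -EA.
move: wA; rewrite {1}EA {1}(row_mx_eta w) mul_row_block /delta d10 => /eq_row_mx[E1 E2].
rewrite /S /schur mulmxBr -scalemxAr mulmxA -E2 addrC; congr (_ + _).
have -> : rsubmx w *m (ursubmx A)^T = (- (w 0 0 * A 0 0))%:M.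
  by apply/eqP; rewrite raddfN/= -addr_eq0 addrC scalar_mxM E1 raddf0.
rewrite !mul_scalar_mx scalerA -scaleNr; congr (_ *: _).
by field; rewrite gt_eqF.
Qed.

Lemma integral_marginal0 : d1 = 0 ->
  (\int[lebesgue_tuple R n.+1]_t
     (g (rdot delta (tvec t)) * student_kernel 1 (- p) A m t)%:E =
   (student_const p / Num.sqrt (A 0 0))%:E * \int[lebesgue_tuple R n]_t
     (g (rdot d' (tvec t)) * student_kernel 1 (- (p - 2^-1)) S (rsubmx m) t)%:E)%E.
Proof.
move=> d10; rewrite opprB -(@integral_student_fst n 1 p A m (fun t => g (rdot d' (tvec t)))) //.
  apply: eq_integral => t _; congr (g _ * _)%:E.
  by rewrite rdot_delta d10 mul0r add0r rsubmx_tvec.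
apply: measurableT_comp => //; apply: measurable_rdot => i; exact: measurable_tvec.
Qed.

Lemma integral_marginalN0 : d1 != 0 -> (n%:R + 2) / 2 <= p ->
  (\int[lebesgue_tuple R n.+1]_t
     (g (rdot delta (tvec t)) * student_kernel 1 (- p) A m t)%:E =
   (student_const_n n p / Num.sqrt (\det A * tau))%:E *
   \int[mu]_y (g y * (1 + (y - rdot delta m) ^+ 2 / tau) `^ (n%:R / 2 - p))%:E)%E.
Proof.
move=> d10 pn.
have t0 : 0 < tau by exact: tau_gt0 Apos d10 wA.
pose E := hyperplane_basis d1 d' *m A *m (hyperplane_basis d1 d')^T.
have Epos : posdefmx E by exact: posdef_hyperplane.
(* By [qform_hyperplane], [c y] and [v y] are the constant and the centre of the kernel in the last
   [n] coordinates once y = delta . x is fixed. *)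
pose c y := 1 + (y - rdot delta m) ^+ 2 / tau.
have c0 y : 0 < c y by rewrite ltr_pwDl// divr_ge0 ?sqr_ge0 ?ltW.
pose v y := rsubmx m + ((y - rdot delta m) / tau) *: rsubmx w.
pose F (z : R * n.-tuple R) := g z.1 * student_kernel (c z.1) (- p) E (v z.1) z.2.
have F0 z : 0 <= F z by rewrite mulr_ge0 ?student_kernel_ge0.
have mc : measurable_fun setT c.
  apply: measurable_funD => //; apply: measurable_funM => //.
  by apply: measurable_funX; exact: measurable_funB.
have mF : measurable_fun setT F.
  apply: measurable_funM.
    by apply: measurableT_comp => //; exact: measurable_fst.
  apply: measurable_powR_comp; apply: measurable_funD.
    by apply: measurableT_comp => //; exact: measurable_fst.
  apply: measurable_qform => i.
  rewrite (_ : (fun _ => _) = (fun z => tnth z.2 i -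
     (rsubmx m 0 i + (z.1 - rdot delta m) / tau * rsubmx w 0 i))); last first.
    by apply/funext => z; rewrite !mxE.
  apply: measurable_funB.
    exact: (measurableT_comp (measurable_tnth i) measurable_snd).
  apply: measurable_funD => //; apply: measurable_funM => //.
  by apply: measurable_funM => //; exact: measurable_funB.
have FE x t : g (d1 * x + rdot d' (tvec t)) * student_kernel 1 (- p) A m (cons_pair (x, t)) =
    F (d1 * x + rdot d' (tvec t), t).
  rewrite /F /=; congr (_ * _); rewrite /student_kernel; congr (_ `^ _).
  rewrite (qform_hyperplane Apos d10 wA) addrA.
  have -> : rdot delta (tvec (cons_pair (x, t)) - m) =
      d1 * x + rdot d' (tvec t) - rdot delta m.
    by rewrite rdotDr rdotNr tvec_cons rdot_row_mx.
  rewrite -/tau -/(c _) -/E; congr (_ + qform _ _).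
  by rewrite linearB/= tvec_cons row_mxKr /v opprD addrA.
(* For fixed [t], y = d1 x + d' . t is affine in x with slope [d1], whence the Jacobian. *)
transitivity (\int[lebesgue_tuple R n]_t (`|d1|^-1%:E * \int[mu]_y (F (y, t))%:E))%E.
  rewrite ge0_integral_tupleS; last 2 first.
  - apply/measurable_EFinP; apply: measurable_funM.
      by apply: measurableT_comp => //; apply: measurable_rdot => i; exact: measurable_tvec.
    exact: measurable_student_kernel.
  - by move=> t; rewrite lee_fin mulr_ge0 ?student_kernel_ge0.
  apply: eq_integral => t _.
  rewrite (@ge0_integral_affine _ d1 (rdot d' (tvec t)) (fun y => (F (y, t))%:E))//; last 2 first.
  - apply/measurable_EFinP; apply: (measurableT_comp mF).
    exact: measurable_pair2.
  - by move=> y; rewrite lee_fin.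
  rewrite muleA -EFinM mulVf ?normr_eq0// mul1e.
  apply: eq_integral => x _; rewrite -FE; congr (g _ * _)%:E.
  by rewrite tvec_cons rdot_row_mx.
have mF' : measurable_fun [set: measurableTypeR R * n.-tuple R] (EFin \o F).
  by apply/measurable_EFinP.
have F0' z : (0 <= (EFin \o F) z)%E by rewrite lee_fin.
have mG := @measurable_fun_fubini_tonelli_G _ _ _ _ _ mu (EFin \o F) mF' F0'.
rewrite ge0_integralZl; last 4 first.
- by [].
- exact: mG.
- by move=> t _; apply: integral_ge0 => y _; rewrite lee_fin.
- by rewrite lee_fin.
rewrite -(fubini_tonelli (m1 := mu) (m2 := lebesgue_tuple R n) (EFin \o F) mF' F0').
transitivity (`|d1|^-1%:E * \int[mu]_y ((student_const_n n p / Num.sqrt (\det E))%:E *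
  (g y * c y `^ (n%:R / 2 - p))%:E))%E.
  congr (_ * _)%E; apply: eq_integral => y _ /=; rewrite /F /=.
  under eq_integral do rewrite EFinM.
  rewrite ge0_integralZl//=.
  - by rewrite integral_student// -!EFinM; congr EFin; ring.
  - by apply/measurable_EFinP; exact: measurable_student_kernel.
  - by move=> t _; rewrite lee_fin student_kernel_ge0.
  - by rewrite lee_fin.
rewrite ge0_integralZl//=; last 3 first.
- apply/measurable_EFinP; apply: measurable_funM => //.
  exact: measurable_powR_comp.
- by move=> y _; rewrite lee_fin mulr_ge0 ?powR_ge0.
- by rewrite lee_fin divr_ge0 ?sqrtr_ge0// ltW// student_const_n_gt0.
rewrite muleA -EFinM; congr (_%:E * _)%E.
(* The Jacobian is absorbed by [det_hyperplane]: |d1| sqrt (det E) = sqrt (det A tau). *)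
rewrite mulrCA; congr (_ * _); rewrite -invfM -sqrtr_sqr -sqrtrM ?sqr_ge0//.
by rewrite (det_hyperplane Apos d10 wA).
Qed.

End marginal_step.

(** The law of delta . x is expressed by test functions [g], which go through the induction
    unchanged. A nonzero [delta] forces n > 0, so [n.-1] is a true predecessor. *)
Lemma integral_student_marginal n p (A : 'M[R]_n) (m delta w : 'rV[R]_n) (g : R -> R) :
  posdefmx A -> delta != 0 -> w *m A = delta -> (n%:R + 2) / 2 <= p ->
  measurable_fun setT g -> (forall y, 0 <= g y) ->
  (\int[lebesgue_tuple R n]_t (g (rdot delta (tvec t)) * student_kernel 1 (- p) A m t)%:E =
   (student_const_n n.-1 p / Num.sqrt (\det A * rdot delta w))%:E *
   \int[mu]_y (g y * (1 + (y - rdot delta m) ^+ 2 / rdot delta w) `^ (n.-1%:R / 2 - p))%:E)%E.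
Proof.
elim: n p A m delta w => [|n IH] p A m delta w Apos dn0 wA pn mg g0.
  by move: dn0; rewrite [delta]thinmx0 eqxx.
have n0 : 0 <= n%:R :> R by [].
move: pn; rewrite -natr1 => pn; have p32 : 3 / 2 <= p by lra.
have Ed : delta = row_mx (delta 0 0)%:M (rsubmx (delta : 'rV_(1 + n))) :> 'rV_(1 + n).
  exact: row_mx_eta.
move: dn0 wA; rewrite {}Ed; move: (delta 0 0) (rsubmx _) => d1 d' dn0 wA {delta}.
(* If [delta] ignores the first coordinate, integrate it out; otherwise
   [y = delta . x] replaces it and all other coordinates are integrated out. *)
have [d10|d10] := eqVneq d1 0; last by apply: integral_marginalN0 => //; lra.
have d'0 : d' != 0.
  apply: contra dn0 => /eqP->; rewrite d10 raddf0; apply/eqP; exact: (@row_mx0 R 1 1 n).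
(* A nonzero [d'] needs a coordinate; with [n] a successor, the [n.-1] of the induction hypothesis
   computes. *)
case: n => [|n] in IH p A m w d' mg g0 n0 pn Apos p32 dn0 wA d'0 *.
  by move: d'0; rewrite [d']thinmx0 eqxx.
rewrite (@integral_marginal0 n.+1 p A m d1 d' g)//.
have EA := @posdef_block _ n.+1 A Apos.
have [a0 Spos] : 0 < A 0 0 /\ posdefmx (schur (A 0 0) (ursubmx (A : 'M[R]_(1 + n.+1))) (drsubmx (A : 'M[R]_(1 + n.+1)))).
  by apply: posdef_schur; rewrite -EA.
rewrite (IH _ _ _ d' (rsubmx (w : 'rV[R]_(1 + n.+1))))//; last 2 first.
- exact: (marginal_schurM Apos wA d10).
- by move: pn; rewrite -natr1; lra.
have dE (u : 'rV[R]_(1 + n.+1)) : rdot (row_mx d1%:M d') u = rdot d' (rsubmx u).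
  by rewrite rdot_delta d10 mul0r add0r.
rewrite muleA -EFinM !dE (student_const_nS _ p32) [in RHS]EA det_schur ?gt_eqF//=.
congr (_%:E * _)%E.
  by rewrite -[A 0 0 * _ * _]mulrA (sqrtrM _ (ltW a0)) invfM; ring.
apply: eq_integral => y _; congr (_ * _ `^ _)%:E.
by rewrite -natr1; field.
Qed.

End student_integrals.

(** * The binomial series and Euler's integral *)

Section binomial_series.
Variable R : realType.
Implicit Types (a w t : R) (n : nat).

(** The coefficient of w^n in (1 - w)^(-a); with this sign it is nonnegative for a > 0. *)
Definition binomial_coef a n : R := pochhammer a n / n`!%:R.

Lemma pochhammerS a n : pochhammer a n.+1 = pochhammer a n * (a + n%:R).
Proof. by rewrite /pochhammer big_ord_recr. Qed.

Lemma pochhammerSl a n : pochhammer a n.+1 = a * pochhammer (a + 1) n.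
Proof.
rewrite /pochhammer big_ord_recl/= addr0; congr (_ * _).
by apply: eq_bigr => i _; rewrite /bump/= -addrA nat1r.
Qed.

Lemma pochhammer_gt0 a n : 0 < a -> 0 < pochhammer a n.
Proof. by move=> a0; apply: prodr_gt0 => i _; rewrite ltr_pwDl. Qed.

Lemma binomial_coef_ge0 a n : 0 < a -> 0 <= binomial_coef a n.
Proof. by move=> a0; rewrite divr_ge0// ltW// pochhammer_gt0. Qed.

Lemma binomial_coefS a n : n.+1%:R * binomial_coef a n.+1 = (a + n%:R) * binomial_coef a n.
Proof.
rewrite /binomial_coef pochhammerS factS natrM; field.
by rewrite nat1r !pnatr_eq0 -lt0n fact_gt0.
Qed.

Lemma pseries_diffs_binomial a n :
  pseries_diffs (binomial_coef a) n = a * binomial_coef (a + 1) n.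
Proof.
rewrite /pseries_diffs /binomial_coef pochhammerSl factS natrM; field.
by rewrite nat1r !pnatr_eq0 -lt0n fact_gt0.
Qed.

Definition binomial_sum a n w : R := pseries (binomial_coef a) w n.

Lemma binomial_sumS a n w :
  binomial_sum a n.+1 w = binomial_sum a n w + binomial_coef a n * w ^+ n.
Proof. by rewrite /binomial_sum /pseries seriesEnat/= big_nat_recr. Qed.

Lemma is_derive_onem_powR a t : t < 1 ->
  is_derive t 1 (fun s => (1 - s) `^ a) (- (a * (1 - t) `^ (a - 1))).
Proof.
move=> t1; have t0 : 0 < 1 - t by rewrite subr_gt0.
have E s : (1 - 'X : {poly R}).[s] = 1 - s by rewrite !hornerE.
have D : is_derive (1 - 'X : {poly R}).[t] 1 (@powR R ^~ a) (a * (1 - t) `^ (a - 1)).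
  by rewrite E; exact: is_derive1_powR.
have := is_derive1_comp D (is_derive_poly (1 - 'X) t).
rewrite derivB derivX -polyC1 derivC sub0r hornerN hornerC mulrN1.
by rewrite (_ : _ \o _ = fun s => (1 - s) `^ a)//; apply/funext => s /=; rewrite polyC1 E.
Qed.

(** All terms but one cancel, so the partial sums times [(1 - s)^a] decrease on
    [[0, 1[] and stay within an explicit remainder of 1. *)
Lemma is_derive_binomial_sum a n t : t < 1 ->
  is_derive t 1 (fun s => (1 - s) `^ a * binomial_sum a n s)
    (- (n%:R * binomial_coef a n * t ^+ n.-1 * (1 - t) `^ (a - 1))).
Proof.
move=> t1; elim: n => [|n IH].
  rewrite (_ : (fun _ => _) = cst 0) ?mul0r ?oppr0; first exact: is_derive_cst.
  by apply/funext => s; rewrite /binomial_sum /pseries seriesEnat/= big_nil mulr0.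
rewrite (_ : (fun _ => _) = (fun s => (1 - s) `^ a * binomial_sum a n s) \+
    (fun s => (1 - s) `^ a * (binomial_coef a n * s ^+ n))); last first.
  by apply/funext => s; rewrite binomial_sumS mulrDr.
have D : is_derive t 1 (fun s => (1 - s) `^ a * (binomial_coef a n * s ^+ n))
   ((1 - t) `^ a * (binomial_coef a n * (n%:R * t ^+ n.-1)) +
    (binomial_coef a n * t ^+ n) * - (a * (1 - t) `^ (a - 1))).
  have E s : (binomial_coef a n *: 'X^n).[s] = binomial_coef a n * s ^+ n.
    by rewrite hornerZ hornerXn.
  have E' : (binomial_coef a n *: 'X^n)^`().[t] = binomial_coef a n * (n%:R * t ^+ n.-1).
    by rewrite derivZ derivXn hornerZ hornerMn hornerXn mulr_natl.
  have := is_deriveM (is_derive_onem_powR a t1)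
    (is_derive_poly (binomial_coef a n *: 'X^n) t).
  rewrite E E' (_ : (fun s => (1 - s) `^ a) * _ =
    (fun s => (1 - s) `^ a * (binomial_coef a n * s ^+ n)))//.
  by apply/funext => s; rewrite -E.
apply: (is_derive_eq (is_deriveD IH D)).
have E : (1 - t) `^ a = (1 - t) * (1 - t) `^ (a - 1).
  have t0 : 0 < 1 - t by rewrite subr_gt0.
  by rewrite powRB ?(gt_eqF t0) ?implybT// powRr1 ?ltW// mulrCA divff ?mulr1// gt_eqF.
(* With (1 - t)^(a-1) factored out, the recurrence of the coefficients cancels all but the last
   term. The case 0 is apart because [0.-1] is 0. *)
rewrite binomial_coefS E; case: n => [|n] in IH D *.
  by rewrite /= !mul0r mulr0 expr0; ring.
by rewrite /= exprS; ring.
Qed.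

Lemma MVT_origin (f df : R -> R) w : (forall t, t < 1 -> is_derive t (1 : R) f (df t)) ->
  w < 1 -> exists2 c, `|c| <= `|w| & f w - f 0 = df c * w.
Proof.
move=> fdf w1.
have cf x y : y < 1 -> {within `[x, y], continuous f}.
  move=> y1; apply: derivable_within_continuous => z; rewrite in_itv/= => /andP[_ zy].
  by have [] := fdf z (le_lt_trans zy y1).
have [w0|w0] := leP 0 w.
  have [] := @MVT_segment _ f df 0 w w0 _ (cf _ _ w1).
    by move=> x; rewrite in_itv/= => /andP[_ xw]; apply: fdf; exact: lt_trans w1.
  move=> c; rewrite in_itv/= => /andP[c0 cw]; rewrite subr0 => E.
  by exists c => //; rewrite !ger0_norm.
have [] := @MVT_segment _ f df w 0 (ltW w0) _ (cf _ _ ltr01).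
  by move=> x; rewrite in_itv/= => /andP[_ x0]; apply: fdf; exact: lt_trans ltr01.
move=> c; rewrite in_itv/= => /andP[cw c0]; rewrite sub0r mulrN => E.
by exists c; [rewrite !ler0_norm ?lerN2// ltW|rewrite -opprB E opprK].
Qed.

Lemma binomial_sum0 a n : binomial_sum a n.+1 0 = 1.
Proof.
rewrite /binomial_sum /pseries seriesEnat/= big_nat_recl//= expr0 mulr1.
rewrite /binomial_coef /pochhammer big_ord0 divr1 big1 ?addr0// => i _.
by rewrite expr0n mulr0.
Qed.

(** Used twice: it bounds the monotone partial sums, whence convergence, and it later provides the
    majorant for dominated convergence. *)
Lemma binomial_sum_le a n w : 0 < a -> 0 <= w < 1 ->
  binomial_sum a n w <= (1 - w) `^ (- a).
Proof.
move=> a0 /andP[w0 w1]; have w10 : 0 < 1 - w by rewrite subr_gt0.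
case: n => [|n].
  by rewrite /binomial_sum /pseries seriesEnat/= big_nil powR_ge0.
pose df t := - (n.+1%:R * binomial_coef a n.+1 * t ^+ n * (1 - t) `^ (a - 1)).
have [] := @MVT_segment R (fun s => (1 - s) `^ a * binomial_sum a n.+1 s) df 0 w w0.
- move=> x; rewrite in_itv/= => /andP[_ xw].
  exact: (is_derive_binomial_sum a n.+1 (lt_trans xw w1)).
- apply: derivable_within_continuous => z; rewrite in_itv/= => /andP[_ zy].
  by have [] := is_derive_binomial_sum a n.+1 (le_lt_trans zy w1).
move=> c; rewrite in_itv/= => /andP[c0 cw]; rewrite binomial_sum0 !subr0 powR1 mulr1 => E.
rewrite powRN -[leRHS]mul1r ler_pdivlMr ?powR_gt0// mulrC -subr_le0 E /df mulNr oppr_le0.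
have B := binomial_coef_ge0 n.+1 a0.
exact: mulr_ge0 (mulr_ge0 (mulr_ge0 (mulr_ge0 (ler0n _ _) B) (exprn_ge0 _ c0)) (powR_ge0 _ _)) w0.
Qed.

Lemma is_cvg_binomial a w : 0 < a -> 0 <= w < 1 -> cvgn (pseries (binomial_coef a) w).
Proof.
move=> a0 w01; have /andP[w0 w1] := w01; apply: nondecreasing_is_cvgn.
  apply: nondecreasing_series => n _ _.
  by rewrite mulr_ge0 ?exprn_ge0// binomial_coef_ge0.
exists ((1 - w) `^ (- a)) => _ [n _ <-]; exact: binomial_sum_le.
Qed.

Lemma norm_binomial_sum_le a n w : 0 < a -> `|w| < 1 ->
  `|binomial_sum a n w| <= (1 - `|w|) `^ (- a).
Proof.
move=> a0 w1; apply: (@le_trans _ _ (binomial_sum a n `|w|)).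
  rewrite /binomial_sum /pseries !seriesEnat/= (le_trans (ler_norm_sum _ _ _))//.
  by apply: ler_sum => i _; rewrite normrM normrX ger0_norm// binomial_coef_ge0.
by apply: binomial_sum_le => //; rewrite normr_ge0.
Qed.

(** By the mean value theorem, (1 - w)^a times a partial sum differs from 1 by at most a constant
    times a term, at |w|, of the binomial series with parameter a + 1. That series converges, so its
    terms tend to 0. *)
Lemma cvg_binomial a w : 1 <= a -> `|w| < 1 ->
  pseries (binomial_coef a) w @ \oo --> (1 - w) `^ (- a).
Proof.
move=> a1 w1; have a0 : 0 < a by lra.
have w10 : 0 < 1 - w by rewrite subr_gt0 (le_lt_trans (ler_norm _)).
(* The factor 2^(a-1) bounds (1 - c)^(a-1) for |c| < 1, which uses a >= 1. *)
have cv : 2 `^ (a - 1) * (pseries_diffs (binomial_coef a) n * `|w| ^+ n) @[n --> \oo] --> 0.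
  have w01 : 0 <= `|w| < 1 by rewrite normr_ge0.
  have := cvg_series_cvg_0 (is_cvg_binomial (addr_gt0 a0 ltr01) w01).
  move=> /(cvgMl_tmp (a := 2 `^ (a - 1) * a)); rewrite mulr0; apply: cvg_trans.
  apply: near_eq_cvg; apply: nearW => n.
  by rewrite pseries_diffs_binomial !mulrA.
have bound n : `|(1 - w) `^ a * binomial_sum a n.+1 w - 1| <=
    2 `^ (a - 1) * (pseries_diffs (binomial_coef a) n * `|w| ^+ n).
  have [c cw] := MVT_origin (is_derive_binomial_sum a n.+1) (le_lt_trans (ler_norm w) w1).
  rewrite binomial_sum0 subr0 powR1 mulr1 => ->.
  have c1 : `|c| < 1 by exact: le_lt_trans cw w1.
  have c10 : 0 <= 1 - c by rewrite subr_ge0 ltW// (le_lt_trans (ler_norm _)).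
  rewrite -[n.+1%:R * _]/(pseries_diffs (binomial_coef a) n) /=.
  have : 0 <= pseries_diffs (binomial_coef a) n.
    exact: mulr_ge0 (ler0n _ _) (binomial_coef_ge0 _ a0).
  move: (pseries_diffs _ _) => D D0.
  rewrite mulNr normrN !normrM normrX (ger0_norm D0) (ger0_norm (powR_ge0 _ _)).
  rewrite -[leRHS]mulr1; apply: ler_pM => //; last exact: ltW.
    by rewrite !mulr_ge0 ?exprn_ge0 ?powR_ge0.
  rewrite mulrC; apply: ler_pM; rewrite ?mulr_ge0 ?exprn_ge0 ?powR_ge0//.
    rewrite ge0_ler_powR ?nnegrE// ?subr_ge0//.
    by have := ler_norm (- c); rewrite normrN; lra.
  by rewrite ler_wpM2l// lerXn2r// nnegrE.
have : (1 - w) `^ a * binomial_sum a n.+1 w - 1 @[n --> \oo] --> 0.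
  apply/norm_cvg0P; apply: (@squeeze_cvgr _ _ _ _ (cst 0)) cv; last exact: cvg_cst.
  by apply: nearW => n; rewrite normr_ge0 bound.
move=> /(cvgD (cvg_cst (1 : R))); rewrite addr0 => H.
have E : [sequence pseries (binomial_coef a) w n.+1]_n = fun n => (1 - w) `^ (- a) *
    ((fun=> 1) + (fun n => (1 - w) `^ a * binomial_sum a n.+1 w - 1)) n.
  apply/funext => n; rewrite fctE addrC subrK mulrA powRN mulVf ?mul1r//.
  by rewrite gt_eqF// powR_gt0.
suff : [sequence pseries (binomial_coef a) w n.+1]_n @ \oo --> (1 - w) `^ (- a).
  by rewrite cvg_shiftS.
by rewrite E -[X in _ --> X]mulr1; apply: cvgMl_tmp.
Qed.

End binomial_series.

Lemma le_powRN (R : realType) (a x y : R) : 0 <= a -> 0 < y -> y <= x ->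
  x `^ (- a) <= y `^ (- a).
Proof.
move=> a0 y0 yx; have x0 : 0 < x by exact: lt_le_trans yx.
rewrite !powRN lef_pV2 ?posrE ?powR_gt0//.
by rewrite ge0_ler_powR ?nnegrE ?(ltW x0) ?(ltW y0).
Qed.

Section euler_integral.
Variable R : realType.
Local Notation mu := (@lebesgue_measure R).
Local Notation D := (`[1%R, +oo[%classic : set R).
Implicit Types (a b c h z x : R).

Let mD : measurable (D : set (measurableTypeR R)). Proof. exact: measurable_itv. Qed.

Lemma cvg_powRN c : 0 < c -> x `^ (- c) @[x --> +oo] --> 0.
Proof.
move=> c0; apply/cvgr0Pnorm_le => e e0.
have d0 : 0 < e `^ (- c^-1) by exact: powR_gt0.
near=> x; have xd : e `^ (- c^-1) <= x by near: x; exact: nbhs_pinfty_ge.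
rewrite ger0_norm ?powR_ge0// powRN -[leRHS]invrK lef_pV2 ?posrE ?invr_gt0 ?powR_gt0//.
  have -> : e^-1 = (e `^ (- c^-1)) `^ c.
    by rewrite -powRrM mulNr mulVf ?gt_eqF// powR_inv1// ltW.
  by rewrite ge0_ler_powR ?nnegrE ?(ltW c0) ?(ltW d0)// (le_trans (ltW d0)).
Unshelve. all: by end_near. Qed.

Lemma integral_powRN c : 0 < c ->
  (\int[mu]_(x in D) (x `^ (- c - 1))%:E = (c^-1)%:E)%E.
Proof.
move=> c0.
have dF x : 0 < x -> is_derive x 1 (fun y => - c^-1 * y `^ (- c)) (x `^ (- c - 1)).
  move=> x0; have := is_deriveZ (- c^-1) (is_derive1_powR (- c) x0).
  by move=> H; apply: (is_derive_eq H); rewrite /GRing.scale/=; field; rewrite gt_eqF.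
rewrite (@ge0_continuous_FTC2y _ _ (fun x => - c^-1 * x `^ (- c)) 1 0).
- by rewrite powR1 mulr1 -EFinN opprK add0e.
- by move=> x _; exact: powR_ge0.
- apply: derivable_within_continuous => x; rewrite in_itv/= andbT => x1.
  by have [] := is_derive1_powR (- c - 1) (lt_le_trans ltr01 x1).
- rewrite -(mulr0 (- c^-1)); apply: cvgMl_tmp; exact: cvg_powRN.
- by move=> x x1; have [] := dF x (lt_trans ltr01 x1).
- apply: cvg_at_right_filter.
  by have [/derivable1_diffP/differentiable_continuous] := dF 1 ltr01.
- move=> x; rewrite in_itv/= andbT => x1; rewrite derive1E.
  by have [_ ->] := dF x (lt_trans ltr01 x1).
Qed.

(** All integrands below are the weight x^(-c-1) times a factor bounded on [1, +oo[. *)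
Lemma integrable_powRN_bounded c (phi : R -> R) (C : R) : 0 < c ->
  measurable_fun [set: R] phi -> (forall x, 1 <= x -> `|phi x| <= C) ->
  mu.-integrable D (EFin \o (fun x => x `^ (- c - 1) * phi x)).
Proof.
move=> c0 mphi phiC.
have C0 : 0 <= C by exact: le_trans (normr_ge0 _) (phiC 1 (lexx _)).
have i1 : mu.-integrable D (fun x => C%:E * (x `^ (- c - 1))%:E)%E.
  apply: integrableZl => //; apply/integrableP; split.
    by apply/measurable_EFinP; apply: measurable_funTS; exact: measurable_powR_comp.
  under eq_integral do rewrite gee0_abs ?lee_fin ?powR_ge0//.
  by rewrite integral_powRN// ltry.
apply: (le_integrable _ _ _ i1) => //.
- apply/measurable_EFinP; apply: measurable_funTS; by apply: measurable_funM.
- move=> x; rewrite /= in_itv/= andbT => x1; rewrite lee_fin.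
  by rewrite !normrM (ger0_norm C0) mulrC ler_wpM2r// phiC.
Qed.

Variables (a b : R).
Hypotheses (a1 : 1 <= a) (b0 : 0 < b).
Let c := 2 * b.
Let c0 : 0 < c. Proof. by rewrite mulr_gt0. Qed.

(** Euler's integral [b \int_0^1 t^(b-1) (1 - z t)^(-a) dt] after [t = x^(-2)],
    which makes the Student tail a mere rescaling of it. *)
Definition euler_integral z : R :=
  c * \int[mu]_(x in D) (x `^ (- c - 1) * (1 - z / x ^+ 2) `^ (- a)).

(** [y `^ (- 1)] stands for [y^-1], to use the measurability of [powR]. *)
Definition euler_coef z k : R := c * (binomial_coef a k *
  \int[mu]_(x in D) (x `^ (- c - 1) * ((1 - z / x ^+ 2) `^ (- a) * ((x ^+ 2 - z) `^ (- 1)) ^+ k))).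

(** As x goes from 1 to +oo the base moves monotonically from 1 - z to 1. *)
Lemma euler_base_ge z x : z < 1 -> 1 <= x -> Num.min 1 (1 - z) <= 1 - z / x ^+ 2.
Proof.
move=> z1 x1; have x21 : 1 <= x ^+ 2 by rewrite exprn_ege1.
have x20 : 0 < x ^+ 2 by rewrite (lt_le_trans _ x21).
have [z0|z0] := leP 0 z.
  rewrite ge_min; apply/orP; right; rewrite lerD2l lerN2 ler_pdivrMr//.
  by rewrite -[leLHS]mulr1 ler_wpM2l.
rewrite ge_min; apply/orP; left; rewrite lerDl oppr_ge0.
by rewrite ler_pdivrMr// mul0r ltW.
Qed.

Lemma euler_base_gt0 z x : z < 1 -> 1 <= x -> 0 < 1 - z / x ^+ 2.
Proof.
move=> z1 x1; apply: lt_le_trans (euler_base_ge z1 x1).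
by rewrite lt_min ltr01 subr_gt0.
Qed.

Lemma measurable_euler_base z : measurable_fun [set: R] (fun x => (1 - z / x ^+ 2) `^ (- a)).
Proof.
apply: measurable_powR_comp; apply: measurable_funB => //.
apply: measurable_funM => //.
rewrite (_ : (fun _ => _) = (fun x => (x ^+ 2) `^ (- 1))).
  by apply: measurable_powR_comp; exact: measurable_funX.
by apply/funext => x; rewrite powR_inv1// sqr_ge0.
Qed.

Lemma measurable_euler_ratio z : measurable_fun [set: R] (fun x => (x ^+ 2 - z) `^ (- 1)).
Proof.
by apply: measurable_powR_comp; apply: measurable_funB => //; exact: measurable_funX.
Qed.

Lemma euler_base_le z x : z < 1 -> 1 <= x ->
  `|(1 - z / x ^+ 2) `^ (- a)| <= (Num.min 1 (1 - z)) `^ (- a).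
Proof.
move=> z1 x1; rewrite ger0_norm ?powR_ge0// le_powRN ?euler_base_ge ?(le_trans ler01)//.
by rewrite lt_min ltr01 subr_gt0.
Qed.

Lemma euler_ratio_le z x : z < 1 -> 1 <= x ->
  0 <= (x ^+ 2 - z) `^ (- 1) <= (1 - z)^-1.
Proof.
move=> z1 x1; rewrite powR_ge0/=; have x21 : 1 <= x ^+ 2 by rewrite exprn_ege1.
have p1 : 0 < x ^+ 2 - z by lra.
have p2 : 0 < 1 - z by lra.
by rewrite powR_inv1 ?(ltW p1)// lef_pV2 ?posrE// lerD2r.
Qed.

Lemma integrable_euler z k : z < 1 -> mu.-integrable D (EFin \o (fun x =>
  x `^ (- c - 1) * ((1 - z / x ^+ 2) `^ (- a) * ((x ^+ 2 - z) `^ (- 1)) ^+ k))).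
Proof.
move=> z1; apply: (@integrable_powRN_bounded _ _ ((Num.min 1 (1 - z)) `^ (- a) * (1 - z)^-1 ^+ k)) => //.
  apply: measurable_funM; first exact: measurable_euler_base.
  by apply: measurable_funX; exact: measurable_euler_ratio.
move=> x x1; rewrite normrM ler_pM// ?euler_base_le// normrX lerXn2r ?nnegrE//.
  by rewrite invr_ge0 subr_ge0 ltW.
by have /andP[r0 rz] := euler_ratio_le z1 x1; rewrite ger0_norm.
Qed.

(** Value and integrability go through one induction, since adding the next term under the integral
    requires the integrability of the previous sum. *)
Lemma pseries_euler z h n : z < 1 ->
  pseries (euler_coef z) h n = c * \int[mu]_(x in D) (x `^ (- c - 1) *
    ((1 - z / x ^+ 2) `^ (- a) * binomial_sum a n (h * (x ^+ 2 - z) `^ (- 1)))) /\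
  mu.-integrable D (EFin \o (fun x => x `^ (- c - 1) *
    ((1 - z / x ^+ 2) `^ (- a) * binomial_sum a n (h * (x ^+ 2 - z) `^ (- 1))))).
Proof.
move=> z1; elim: n => [|n [IHs IHi]].
  have E : (fun x => x `^ (- c - 1) * ((1 - z / x ^+ 2) `^ (- a) *
      binomial_sum a 0 (h * (x ^+ 2 - z) `^ (- 1)))) = cst 0.
    by apply/funext => x; rewrite /binomial_sum /pseries seriesEnat/= big_nil !mulr0.
  rewrite E; split; last exact: integrable0.
  by rewrite /pseries seriesEnat/= big_nil Rintegral_cst//= mul0r mulr0.
have E : (fun x => x `^ (- c - 1) * ((1 - z / x ^+ 2) `^ (- a) *
    binomial_sum a n.+1 (h * (x ^+ 2 - z) `^ (- 1)))) =
  (fun x => x `^ (- c - 1) * ((1 - z / x ^+ 2) `^ (- a) *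
    binomial_sum a n (h * (x ^+ 2 - z) `^ (- 1))) +
   (binomial_coef a n * h ^+ n) * (x `^ (- c - 1) * ((1 - z / x ^+ 2) `^ (- a) *
     ((x ^+ 2 - z) `^ (- 1)) ^+ n))).
  by apply/funext => x; rewrite binomial_sumS exprMn; ring.
have I := integrable_euler n z1.
have I' : mu.-integrable D (EFin \o (fun x => (binomial_coef a n * h ^+ n) *
    (x `^ (- c - 1) * ((1 - z / x ^+ 2) `^ (- a) * ((x ^+ 2 - z) `^ (- 1)) ^+ n)))).
  have := integrableZl mD (binomial_coef a n * h ^+ n) I.
  by apply: eq_integrable => // x _; rewrite /= EFinM.
rewrite E; split.
  rewrite RintegralD// RintegralZl// mulrDr -IHs /pseries !seriesEnat/= big_nat_recr//=.
  by congr (_ + _); rewrite /euler_coef; ring.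
have := integrableD mD IHi I'.
by apply: eq_integrable => // x _; rewrite /= EFinD.
Qed.

(** The factorisation 1 - (z + h) / x^2 = (1 - z / x^2) (1 - h / (x^2 - z)) moves the dependence on
    [h] into a binomial series, whose ratio on [1, +oo[ is at most |h| / (1 - z) < 1. *)
Lemma cvg_euler z h : z < 1 -> `|h| < 1 - z ->
  pseries (euler_coef z) h @ \oo --> euler_integral (z + h).
Proof.
move=> z1 hz; have z10 : 0 < 1 - z by rewrite subr_gt0.
pose f_ n x := (x `^ (- c - 1) * ((1 - z / x ^+ 2) `^ (- a) *
   binomial_sum a n (h * (x ^+ 2 - z) `^ (- 1))))%:E.
pose f x := (x `^ (- c - 1) * (1 - (z + h) / x ^+ 2) `^ (- a))%:E.
(* The first factor bounds (1 - z / x^2)^(-a), the second bounds all partial sums by the closed form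
   at the largest ratio, attained at x = 1. *)
pose C := (Num.min 1 (1 - z)) `^ (- a) * (1 - `|h| / (1 - z)) `^ (- a).
have C0 : 0 <= C by rewrite mulr_ge0 ?powR_ge0.
pose g x := (x `^ (- c - 1) * cst C x)%:E.
have rho x : 1 <= x -> `|h * (x ^+ 2 - z) `^ (- 1)| <= `|h| / (1 - z).
  move=> x1; have /andP[r0 rz] := euler_ratio_le z1 x1.
  by rewrite normrM (ger0_norm r0) ler_wpM2l.
have rho1 : `|h| / (1 - z) < 1 by rewrite ltr_pdivrMr// mul1r.
have ig : mu.-integrable D g.
  apply: (@integrable_powRN_bounded _ _ C) => // x _; by rewrite ger0_norm.
have mf_ n : measurable_fun D (f_ n).
  by have [_ /integrableP[]] := pseries_euler h n z1.
have mf : measurable_fun D f.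
  apply/measurable_EFinP; apply: measurable_funTS; apply: measurable_funM.
    exact: measurable_powR_comp.
  exact: measurable_euler_base.
have cf : {ae mu, forall x, D x -> f_ ^~ x @ \oo --> f x}.
  apply: aeW => x; rewrite /= in_itv/= andbT => x1.
  have x21 : 1 <= x ^+ 2 by rewrite exprn_ege1.
  have xz : 0 < x ^+ 2 - z by lra.
  have x20 : 0 < x ^+ 2 by lra.
  have w1 := le_lt_trans (rho x x1) rho1.
  apply: cvg_EFin; first exact: nearW.
  rewrite /f_ /f /comp /=.
  have -> : (1 - (z + h) / x ^+ 2) `^ (- a) = (1 - z / x ^+ 2) `^ (- a) *
      (1 - h * (x ^+ 2 - z) `^ (- 1)) `^ (- a).
    rewrite -powRM; last 2 first.
    - exact/ltW/euler_base_gt0.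
    - by rewrite subr_ge0 ltW// (le_lt_trans (ler_norm _)).
    congr (_ `^ _); rewrite powR_inv1 ?ltW//; field.
    by rewrite (gt_eqF xz) (gt_eqF (lt_le_trans ltr01 x1)).
  exact: (cvgMl_tmp (cvgMl_tmp (cvg_binomial a1 w1))).
have fg : {ae mu, forall x n, D x -> (`|f_ n x| <= g x)%E}.
  apply: aeW => x n; rewrite /= in_itv/= andbT => x1.
  rewrite lee_fin normrM (ger0_norm (powR_ge0 _ _)) ler_wpM2l ?powR_ge0//.
  rewrite normrM ler_pM// ?euler_base_le//.
  have w1 := le_lt_trans (rho x x1) rho1.
  apply: le_trans (norm_binomial_sum_le _ _ w1) _; first exact: lt_le_trans ltr01 a1.
  by apply: le_powRN; [exact: le_trans a1|rewrite subr_gt0|rewrite lerD2l lerN2 rho].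
have [_ _ H] := dominated_convergence mD mf_ mf cf ig fg.
have iff : mu.-integrable D f.
  by have [] := dominated_convergence mD mf_ mf cf ig fg.
have -> : pseries (euler_coef z) h = (fun n => c * fine (\int[mu]_(x in D) f_ n x)).
  by apply/funext => n; have [-> _] := pseries_euler h n z1.
apply: cvgMl_tmp; apply: fine_cvg.
by rewrite fineK//; exact: integrable_fin_num iff.
Qed.

(** At z = 0 the integrand is the pure power x^(-2b-1-2k), so the k-th integral times 2b is b / (b +
    k), the quotient of the Pochhammer symbols of b and b + 1. *)
Lemma euler_coef0 k : euler_coef 0 k = gauss_coef a b (b + 1) k.
Proof.
have E : (\int[mu]_(x in D) (x `^ (- c - 1) * ((1 - 0 / x ^+ 2) `^ (- a) *
    ((x ^+ 2 - 0) `^ (- 1)) ^+ k))) = (c + 2 * k%:R)^-1.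
  have k0 : 0 <= k%:R :> R by [].
  rewrite -[RHS]/(fine (c + 2 * k%:R)^-1%:E) -integral_powRN; last by have := c0; lra.
  congr fine; apply: eq_integral => x; rewrite inE/= in_itv/= andbT => x1.
  have x0 : 0 < x by lra.
  rewrite mul0r !subr0 powR1 mul1r; congr EFin.
  rewrite -powR_mulrn ?powR_ge0// -powRrM -powR_mulrn ?ltW// -powRrM -powRD.
    by congr (_ `^ _); ring.
  by rewrite (gt_eqF x0) implybT.
have P : pochhammer b k * (b + k%:R) = b * pochhammer (b + 1) k.
  by rewrite -pochhammerS pochhammerSl.
have p0 : pochhammer (b + 1) k != 0 by rewrite gt_eqF// pochhammer_gt0// addr_gt0.
have bk : b + k%:R != 0 by rewrite gt_eqF// ltr_pwDl.
rewrite /euler_coef E /gauss_coef /binomial_coef /c.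
have -> : pochhammer b k = b * pochhammer (b + 1) k / (b + k%:R) by rewrite -P mulfK.
field.
by rewrite -mulrDr mulf_neq0// bk p0 pnatr_eq0 -lt0n fact_gt0.
Qed.

End euler_integral.

(** * Uniqueness of the real-analytic continuation *)

Section identity_theorem.
Variable R : realType.
Implicit Types (u v : R^nat) (F G : R -> R) (x h : R).

Lemma pseries_recl u h n :
  pseries u h n.+1 = u 0%N + h * pseries (fun k => u k.+1) h n.
Proof.
rewrite /pseries !seriesEnat/= big_nat_recl//= expr0 mulr1 mulr_sumr; congr (_ + _).
by apply: eq_bigr => i _; rewrite exprS; ring.
Qed.

(** Since u_0 is the sum minus h times the shifted series, and the latter is bounded by absolute
    convergence, letting h tend to 0 from the right forces u_0 = 0. The hypothesis is one-sided
    because the identity theorem below knows equality only to the right of a critical point. *)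
Lemma pseries_right_eq0_head u (e : R) : 0 < e ->
  (forall h, 0 < h < e -> pseries u h @ \oo --> 0) -> u 0%N = 0.
Proof.
(* Then 2 r is still below [e]: convergence at 2 r gives absolute convergence at r. *)
move=> e0 ue; pose r := e / 3; have r0 : 0 < r by rewrite /r; lra.
have C : cvgn (pseries (fun k => `|u k|) r).
  apply: (@is_cvg_pseries_inside_norm _ _ (2 * r)).
    by apply: cvgP (ue (2 * r) _); rewrite /r; lra.
  by rewrite !ger0_norm; rewrite /r; lra.
pose L := limn (pseries (fun k => `|u k|) r).
have bound h n : 0 < h <= r -> `|u 0%N| <= `|pseries u h n.+1| + h / r * L.
  move=> /andP[h0 hr].
  have -> : u 0%N = pseries u h n.+1 - h * pseries (fun k => u k.+1) h n.
    by rewrite pseries_recl addrK.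
  rewrite (le_trans (ler_normB _ _))// lerD2l normrM (gtr0_norm h0) -mulrA ler_wpM2l ?(ltW h0)//.
  apply: (@le_trans _ _ (r^-1 * (r * pseries (fun k => `|u k.+1|) r n))).
    rewrite mulKf ?gt_eqF// /pseries !seriesEnat/= (le_trans (ler_norm_sum _ _ _))//.
    apply: ler_sum => i _; rewrite normrM normrX ler_wpM2l//.
    by rewrite lerXn2r ?nnegrE ?(ltW r0)// gtr0_norm.
  rewrite ler_wpM2l ?invr_ge0 ?(ltW r0)//.
  apply: (@le_trans _ _ (pseries (fun k => `|u k|) r n.+1)).
    by rewrite pseries_recl lerDr.
  apply: nondecreasing_cvgn_le => //; apply: nondecreasing_series => i _ _.
  by rewrite mulr_ge0 ?exprn_ge0// ltW.
have L0 : 0 <= L.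
  apply: limr_ge => //; apply: nearW => n; rewrite /pseries seriesEnat/= sumr_ge0// => i _.
  by rewrite mulr_ge0 ?exprn_ge0// ltW.
have bound' h : 0 < h <= r -> `|u 0%N| <= h / r * L.
  move=> hr; have /andP[h0 hr'] := hr.
  have h3 : 0 < h < e by rewrite h0/=; move: hr'; rewrite /r; lra.
  have H : pseries u h n.+1 @[n --> \oo] --> 0 by rewrite cvg_shiftS; exact: ue.
  have H' : `|pseries u h n.+1| + h / r * L @[n --> \oo] --> h / r * L.
    rewrite -[X in _ --> X]add0r; apply: cvgD; last exact: cvg_cst.
    by rewrite -[X in _ --> X](normr0 R); exact: cvg_norm.
  rewrite -(cvg_lim _ H')//; apply: limr_ge; first exact: cvgP H'.
  by apply: nearW => n; exact: bound.
apply/eqP; rewrite -normr_le0; apply/ler_addgt0Pr => d d0; rewrite add0r.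
(* Chosen so that h / r times L is at most d; L + 1 is positive even if L = 0. *)
pose h := Num.min r (r * d / (L + 1)).
have h0 : 0 < h by rewrite lt_min r0 divr_gt0 ?mulr_gt0//; lra.
apply: le_trans (bound' h _) _; first by rewrite h0 ge_min lexx.
have hd : h / r <= d / (L + 1).
  rewrite ler_pdivrMr// (le_trans (_ : h <= r * d / (L + 1)))// ?ge_min ?lexx ?orbT//.
  by rewrite [leRHS]mulrC mulrA.
apply: le_trans (ler_wpM2r L0 hd) _; rewrite mulrAC ler_pdivrMr; last by lra.
by rewrite ler_wpM2l ?(ltW d0)//; lra.
Qed.

(** Once u_0 = 0, dividing by h gives the shifted series, which vanishes on the same interval. *)
Lemma pseries_right_eq0 u (e : R) : 0 < e ->
  (forall h, 0 < h < e -> pseries u h @ \oo --> 0) -> forall k, u k = 0.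
Proof.
move=> e0 ue k; elim: k u ue => [|k IH] u ue; first exact: pseries_right_eq0_head ue.
apply: (IH (fun k => u k.+1)) => h he; have /andP[h0 _] := he.
have u0 := pseries_right_eq0_head e0 ue.
have : pseries u h n.+1 @[n --> \oo] --> 0 by rewrite cvg_shiftS; exact: ue.
move=> /(cvgMl_tmp (a := h^-1)) H.
have -> : pseries (fun k => u k.+1) h = (fun n => h^-1 * pseries u h n.+1).
  by apply/funext => n; rewrite pseries_recl u0 add0r mulKf// gt_eqF.
by rewrite -[X in _ --> X](mulr0 h^-1); exact: H.
Qed.

(** Let s be the leftmost point down to which F and G agree from 1. They agree to its right, so
    their expansions at s coincide and they agree a little to its left too, against the choice of s.
    A point z of disagreement makes s finite. *)
Lemma real_analytic_eq F G : real_analytic_on `]-oo, 1[ F -> real_analytic_on `]-oo, 1[ G ->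
  (forall x, `|x| < 1 -> F x = G x) -> forall x, x < 1 -> F x = G x.
Proof.
move=> aF aG FG z z1; apply: contrapT => FGz.
pose S := [set x | x < 1 /\ forall y, x <= y < 1 -> F y = G y].
have S0 : S 0.
  by split=> // y /andP[y0 y1]; apply: FG; rewrite ger0_norm.
have lbS : lbound S z.
  move=> x [x1 Sx]; rewrite leNgt; apply/negP => xz.
  by apply: FGz; apply: Sx; rewrite z1 ltW.
have iS : has_inf S by split; [exists 0|exists z].
pose s := inf S.
have s0 : s <= 0 by apply: ge_inf S0; exists z.
have s1 : s < 1 by exact: le_lt_trans ltr01.
have FGs y : s < y < 1 -> F y = G y.
  move=> /andP[sy y1]; have ys0 : 0 < y - s by rewrite subr_gt0.
  have [x [x1 Sx] xy] := inf_adherent ys0 iS.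
  by apply: Sx; rewrite y1 andbT ltW//; move: xy; rewrite -/s addrC subrK.
have [u Fu] := aF s s1; have [v Gv] := aG s s1.
have [e /= e0 He] : exists2 e : R, 0 < e & forall x, `|s - x| < e ->
    pseries u (x - s) @ \oo --> F x /\ pseries v (x - s) @ \oo --> G x.
  have /nbhs_ballP[e e0 He] : \forall x \near s,
    pseries u (x - s) @ \oo --> F x /\ pseries v (x - s) @ \oo --> G x.
    by near=> x; split; near: x.
  by exists e => // x xe; apply: He.
have D x : `|s - x| < e -> pseries (fun k => u k - v k) (x - s) @ \oo --> F x - G x.
  move=> /He[Hu Hv].
  have -> : pseries (fun k => u k - v k) (x - s) = pseries u (x - s) - pseries v (x - s).
    apply/funext => n; rewrite /pseries !seriesEnat fctE /= -sumrB.
    by apply: eq_bigr => i _; rewrite mulrBl.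
  exact: cvgB.
(* The second bound keeps s + h in ]s, 1[, where F and G agree. *)
pose e' := Num.min e (1 - s).
have e'0 : 0 < e' by rewrite lt_min e0 subr_gt0.
have uv k : u k - v k = 0.
  apply: (pseries_right_eq0 (u := fun k => u k - v k) e'0) => h /andP[h0].
  rewrite lt_min => /andP[he h1].
  have hs : h = (s + h) - s by rewrite addrAC subrr add0r.
  have E : F (s + h) - G (s + h) = 0.
    by rewrite FGs ?subrr// ltrDl h0/=; lra.
  rewrite -[X in _ --> X]E [X in pseries _ X]hs; apply: D.
  by rewrite opprD addNKr normrN gtr0_norm.
have FGe x : `|s - x| < e -> F x = G x.
  move=> /D; rewrite (_ : (fun k => u k - v k) = cst 0); last exact/funext.
  rewrite (_ : pseries _ _ = cst 0) => [H|].
    by apply/eqP; rewrite -subr_eq0; apply/eqP; apply: (cvg_unique _ H (cvg_cst _)).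
  by apply/funext => n; rewrite /pseries seriesEnat/= big1// => i _; rewrite mul0r.
have : S (s - e / 2).
  split=> [|y /andP[y1 y2]]; first by lra.
  have [ys|ys] := ltP s y; first by apply: FGs; rewrite ys.
  by apply: FGe; rewrite ger0_norm ?subr_ge0//; lra.
move=> /(ge_inf (ex_intro _ z lbS)); rewrite -/s; lra.
Unshelve. all: by end_near. Qed.

Lemma hyp2F1E (a b z : R) : 1 <= a -> 0 < b -> z < 1 ->
  hyp2F1 a b (b + 1) z = euler_integral a b z.
Proof.
move=> a1 b0 z1.
have cont : is_gauss_continuation a b (b + 1) (euler_integral a b).
  split=> [x0 x01|x x1].
    exists (euler_coef a b x0); near=> x.
    rewrite -[in X in _ --> X](subrKC x0 x); apply: cvg_euler => //.
    by rewrite -normrN opprB; near: x; apply: cvgr_dist_lt; rewrite // subr_gt0.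
  rewrite -[x in euler_integral _ _ x]add0r.
  rewrite -(_ : euler_coef a b 0 = gauss_coef a b (b + 1)); last first.
    by apply/funext => k; exact: euler_coef0.
  by apply: cvg_euler; rewrite ?subr0.
(* Whatever continuation [xget] selects has this value by uniqueness; its default 0 is excluded
   because Euler's integral is a candidate. *)
rewrite /hyp2F1; case: xgetP => [y _ [F [aF gF] <-]|/(_ (euler_integral a b z))]; last first.
  by move=> H; exfalso; apply: H; exists (euler_integral a b).
apply: real_analytic_eq => //; first by case: cont.
by move=> x x1; case: cont => _ /(_ x x1); apply: cvg_unique => //; exact: gF.
Unshelve. all: by end_near. Qed.
End identity_theorem.

(** * Tails of Student mixtures *)

Section student_tail.
Variable R : realType.
Implicit Types (a b s v m tau : R).
Local Notation mu := (@lebesgue_measure R).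

Definition half_line_tail a b tau s : R :=
  s * (s ^+ 2 / tau) `^ (- a) / (2 * b) * hyp2F1 a b (b + 1) (- (tau / s ^+ 2)).

(** The map x -> m - s x sends [1, +oo[ onto ]-oo, -v], and 1 + s^2 x^2 / tau = (s^2 / tau) x^2 (1 -
    z / x^2). The relation between [a] and [b] turns x^(-2a) into Euler's weight x^(-2b-1). *)
Lemma integral_half_line a b tau m v : 1 <= a -> 0 < b -> 2 * a = 2 * b + 1 ->
  0 < tau -> 0 < m + v ->
  (\int[mu]_(y in `]-oo, (- v)%R]) ((1 + (y - m) ^+ 2 / tau) `^ (- a))%:E =
   (half_line_tail a b tau (m + v))%:E)%E.
Proof.
move=> a1 b0 ab t0; set s := m + v => s0.
pose z := - (tau / s ^+ 2).
have ts : 0 < tau / s ^+ 2 by rewrite divr_gt0// exprn_gt0.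
have z1 : z < 1 by rewrite /z; lra.
have st : 0 < s ^+ 2 / tau by rewrite divr_gt0// exprn_gt0.
pose k y := (1 + (y - m) ^+ 2 / tau) `^ (- a).
have mk : measurable_fun setT k.
  apply: measurable_powR_comp; apply: measurable_funD => //; apply: measurable_funM => //.
  by apply: measurable_funX; exact: measurable_funB.
have I : mu.-integrable `[1%R, +oo[%classic
    (EFin \o (fun x => x `^ (- (2 * b) - 1) * (1 - z / x ^+ 2) `^ (- a))).
  have := integrable_euler a1 b0 0 z1; apply: eq_integrable => // x _.
  by rewrite /= expr0 mulr1.
rewrite integral_mkcond (@ge0_integral_affine _ (- s) m); last 3 first.
- by rewrite oppr_eq0 gt_eqF.
- by apply/(measurable_restrictT _ _).1 => //; apply/measurable_EFinP; exact: measurable_funTS.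
- by move=> y; apply: erestrict_ge0 => x _; rewrite lee_fin powR_ge0.
rewrite normrN gtr0_norm//.
transitivity (s%:E * \int[mu]_(x in `[1%R, +oo[) ((s ^+ 2 / tau) `^ (- a) *
    (x `^ (- (2 * b) - 1) * (1 - z / x ^+ 2) `^ (- a)))%:E)%E.
  congr (_ * _)%E; rewrite [RHS]integral_mkcond; apply: eq_integral => x _.
  rewrite !patchE.
  have E : (- s * x + m \in (`]-oo, (- v)%R]%classic : set R)) = (x \in (`[1%R, +oo[%classic : set R)).
    apply/idP/idP; rewrite !inE/= !in_itv/= andbT.
      by move=> H; rewrite -(ler_pM2l s0) mulr1 /s; move: H; rewrite /s; lra.
    by rewrite -(ler_pM2l s0) mulr1 => H; move: H; rewrite /s; lra.
  rewrite E; case: ifPn => //; rewrite inE/= in_itv/= andbT => x1; congr EFin.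
  have x0 : 0 < x by lra.
  have zx := euler_base_gt0 z1 x1.
  have -> : x `^ (- (2 * b) - 1) = (x ^+ 2) `^ (- a).
    by rewrite -powR_mulrn ?(ltW x0)// -powRrM; congr (_ `^ _); lra.
  have y0 : 0 <= x ^+ 2 * (1 - z / x ^+ 2) by rewrite mulr_ge0 ?sqr_ge0 ?(ltW zx).
  rewrite -powRM ?sqr_ge0 ?(ltW zx)// -powRM ?(ltW st)//.
  congr (_ `^ _); rewrite /z; field.
  by rewrite !gt_eqF.
under eq_integral do rewrite EFinM.
have mI : measurable_fun (`[1%R, +oo[%classic : set R) (EFin \o (fun x => x `^ (- (2 * b) - 1) * (1 - z / x ^+ 2) `^ (- a))).
  by move/integrableP : I => [].
rewrite ge0_integralZl//; last 2 first.
- by move=> x _; rewrite lee_fin mulr_ge0 ?powR_ge0.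
- by rewrite lee_fin powR_ge0.
rewrite -(fineK (integrable_fin_num _ I))// -!EFinM; congr EFin.
rewrite /half_line_tail -/z hyp2F1E// /euler_integral -/(Rintegral _ _ _).
by field; rewrite gt_eqF.
Qed.

(** Monotonicity is read off the integral, not off 2F1: lowering v' to v adds the positive mass of
    ]-v', -v]. *)
Lemma half_line_tail_lt a b tau m v v' : 1 <= a -> 0 < b -> 2 * a = 2 * b + 1 ->
  0 < tau -> 0 < m + v -> v < v' ->
  half_line_tail a b tau (m + v') < half_line_tail a b tau (m + v).
Proof.
move=> a1 b0 ab t0 s0 vv'; have s0' : 0 < m + v' by lra.
rewrite -lte_fin -(integral_half_line a1 b0 ab t0 s0).
rewrite (_ : `]-oo, (- v)%R]%classic = `]-oo, (- v')%R] `|` `](- v')%R, (- v)%R]); last first.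
  by rewrite -itv_bndbnd_setU// bnd_simp lerN2 ltW.
set k := fun y : R => (1 + (y - m) ^+ 2 / tau) `^ (- a).
have mk D : measurable_fun D (fun y => (k y)%:E).
  apply/measurable_EFinP; apply: measurable_funTS.
  apply: measurable_powR_comp; apply: measurable_funD => //; apply: measurable_funM => //.
  by apply: measurable_funX; exact: measurable_funB.
rewrite ge0_integral_setU//=; last 3 first.
- exact: mk.
- by move=> y _; rewrite lee_fin powR_ge0.
- apply/disj_setPS => y [] /=; rewrite !in_itv/= => y1 /andP[y2 _].
  by move: y2; rewrite ltNge y1.
rewrite [X in (_ < X + _)%E](integral_half_line a1 b0 ab t0 s0') lteDl//.
(* The value at -v', the point of the interval's closure farthest from [m], hence a lower bound of
   the integrand. *)
pose C := (1 + (m + v') ^+ 2 / tau) `^ (- a).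
have C0 : 0 < C by rewrite powR_gt0// ltr_pwDl// divr_ge0 ?sqr_ge0 ?ltW.
apply: (@lt_le_trans _ _ (\int[mu]_(y in `](- v')%R, (- v)%R]) C%:E)%E).
  rewrite integral_cst//= lebesgue_measure_itv/= lte_fin ltrN2 vv' -EFinB -EFinM lte_fin.
  by rewrite mulr_gt0//; lra.
apply: ge0_le_integral => //.
- by move=> y _; rewrite lee_fin ltW.
- exact: mk.
- move=> y; rewrite /= in_itv/= => /andP[y1 y2]; rewrite lee_fin /C.
  apply: le_powRN; first exact: le_trans a1.
    by rewrite ltr_pwDl// divr_ge0 ?sqr_ge0 ?ltW.
  rewrite lerD2l ler_pM2r ?invr_gt0// -subr_ge0 subr_sqr mulr_ge0//; lra.
Qed.

End student_tail.

Lemma posdefmx_det_gt0 (R : realType) n (A : 'M[R]_n) : posdefmx A -> 0 < \det A.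
Proof.
elim: n A => [|n IH] A Apos; first by rewrite det_mx00.
have EA := @posdef_block _ n A Apos.
pose S : 'M[R]_n := schur (A 0 0) (ursubmx (A : 'M[R]_(1 + n))) (drsubmx (A : 'M[R]_(1 + n))).
have [a0 Spos] : 0 < A 0 0 /\ posdefmx S by apply: posdef_schur; rewrite -EA.
by rewrite EA det_schur ?gt_eqF// mulr_gt0// IH.
Qed.

Lemma posdefmx_unit (R : realType) n (A : 'M[R]_n) : posdefmx A -> A \in unitmx.
Proof. by move=> Apos; rewrite unitmxE unitfE gt_eqF// posdefmx_det_gt0. Qed.

Lemma posdefmx_invZ (R : realType) n (A : 'M[R]_n) (c : R) : 0 < c -> posdefmx A ->
  posdefmx (c *: invmx A).
Proof.
move=> c0 Apos; have [As pA] := Apos; have uA := posdefmx_unit Apos; split.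
  by rewrite linearZ/= trmx_inv As.
(* Written this way, the inverse is congruent to [A] and inherits its positivity. *)
move=> u u0; have -> : c *: invmx A = c *: (invmx A *m A *m (invmx A)^T).
  by rewrite trmx_inv As mulVmx// mul1mx.
rewrite {1}/qform -scalemxAr -scalemxAl mxE -/(qform _ _) mulr_gt0// -qform_mulmx.
apply: pA; apply: contra u0 => /eqP E.
by rewrite -[u](mulmxKV uA) E mul0mx.
Qed.

(** * The lower tail of one Student component *)

Section student_component.
Variable R : realType.
Variables (n : nat) (nu : R) (m delta : 'rV[R]_n) (Sigma : 'M[R]_n).
Hypotheses (nu2 : 2 < nu) (Spos : posdefmx Sigma) (delta0 : delta != 0).
(** This is delta A^-1 delta^t for A = Sigma^-1 / nu, the matrix of the kernel in the density. *)
Let tau := nu * qform Sigma delta.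
Let a := (nu + 1) / 2.
Let b := nu / 2.

(** The prefactor normalises the univariate Student law with [nu] degrees of freedom, location delta
    . m and squared scale delta Sigma delta^t. *)
Definition student_lower_prob v : R :=
  Gamma a / (Gamma b * Num.sqrt pi * Num.sqrt tau) * half_line_tail a b tau (rdot delta m + v).

Let tau0 : 0 < tau.
Proof. by rewrite mulr_gt0 ?(proj2 Spos)//; move: nu2; lra. Qed.
Let a1 : 1 <= a. Proof. by rewrite /a; move: nu2; lra. Qed.
Let b0 : 0 < b. Proof. by rewrite /b; move: nu2; lra. Qed.
Let ab : 2 * a = 2 * b + 1. Proof. by rewrite /a /b; field. Qed.
Let Gb0 : 0 < Gamma b. Proof. by rewrite Gamma_gt0// /b; move: nu2; lra. Qed.

Lemma student_lower_prob_lt v v' : 0 < rdot delta m + v -> v < v' ->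
  student_lower_prob v' < student_lower_prob v.
Proof.
move=> s0 vv'; rewrite /student_lower_prob ltr_pM2l; first exact: half_line_tail_lt.
apply: divr_gt0; first exact: Gamma_gt0.
by apply: mulr_gt0; [apply: mulr_gt0; [exact: Gb0|rewrite sqrtr_gt0 pi_gt0]|rewrite sqrtr_gt0].
Qed.

(** For s > 0, s / sqrt tau is (q / nu)^(1/2), which turns the exponent -a of q / nu into -b; the
    factor 1 / (2 b) is 1 / nu. *)
Lemma student_lower_probE v : 0 < rdot delta m + v ->
  let q := (rdot delta m + v) ^+ 2 / qform Sigma delta in
  student_lower_prob v = Gamma a / (nu * Num.sqrt pi * Gamma b) * nu `^ b * q `^ (- b) *
    hyp2F1 ((1 + nu) / 2) b (1 + b) (- (nu / q)).
Proof.
set s := rdot delta m + v => s0 q.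
have nu0 : 0 < nu by move: nu2; lra.
have Q0 : 0 < qform Sigma delta by exact: (proj2 Spos).
have q0 : 0 < q by rewrite divr_gt0// exprn_gt0.
rewrite /student_lower_prob /half_line_tail -/s.
have -> : tau / s ^+ 2 = nu / q by rewrite /tau /q; field; rewrite !gt_eqF.
rewrite [b + 1]addrC (_ : (1 + nu) / 2 = a); last by rewrite /a addrC.
have -> : s ^+ 2 / tau = q / nu by rewrite /tau /q; field; rewrite !gt_eqF.
move: (hyp2F1 _ _ _ _) => H.
have -> : Num.sqrt tau = nu `^ 2^-1 * (s * q `^ (- 2^-1)).
  rewrite /tau sqrtrM ?ltW// powR12_sqrt ?ltW//; congr (_ * _).
  rewrite powRN powR12_sqrt ?(ltW q0)// /q sqrtrM ?sqr_ge0// sqrtr_sqr gtr0_norm//.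
  rewrite sqrtrV ?(ltW Q0)//; field.
  by rewrite !gt_eqF// sqrtr_gt0.
have -> : (q / nu) `^ (- a) = q `^ (- 2^-1) * q `^ (- b) * (nu `^ 2^-1 * nu `^ b).
  rewrite powRM ?invr_ge0 ?ltW// -[nu^-1]powR_inv1 ?ltW// -powRrM.
  rewrite -!powRD ?(gt_eqF q0) ?(gt_eqF nu0) ?implybT//.
  by congr (_ `^ _ * _ `^ _); rewrite /a /b; field.
have h1 : nu `^ 2^-1 != 0 by rewrite gt_eqF// powR_gt0.
have h2 : q `^ (- 2^-1) != 0 by rewrite gt_eqF// powR_gt0.
have h3 : Num.sqrt pi != 0 :> R by rewrite gt_eqF// sqrtr_gt0 pi_gt0.
have h4 : Gamma b != 0 by exact: lt0r_neq0.
have -> : 2 * b = nu by rewrite /b; field.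
move: (q `^ (- 2^-1)) (nu `^ 2^-1) (q `^ (- b)) (nu `^ b) h1 h2 => x1 x2 x3 x4 h1 h2.
move: (Gamma a) (Gamma b) (Num.sqrt pi) h3 h4 => x5 x6 x7 h3 h4.
by field; rewrite h1 h2 h3 h4 !gt_eqF.
Qed.

Lemma student_pdf_kernel (t : n.-tuple R) : student_pdf nu m Sigma (tvec t) =
  Gamma ((nu + n%:R) / 2) / (Gamma b * Num.sqrt (\det Sigma * (nu * pi) ^+ n)) *
  student_kernel 1 (- ((nu + n%:R) / 2)) (nu^-1 *: invmx Sigma) m t.
Proof.
rewrite /student_pdf /student_kernel; congr (_ * _ `^ _); last by field.
congr (_ + _); rewrite {2}/qform -scalemxAr -scalemxAl mxE mulrC.
by [].
Qed.

Lemma integral_student_pdf v : 0 < rdot delta m + v ->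
  (\int[lebesgue_tuple R n]_(t in [set t | (rdot delta (tvec t) <= - v)%R])
     (student_pdf nu m Sigma (tvec t))%:E = (student_lower_prob v)%:E)%E.
Proof.
move=> s0; have nu0 : 0 < nu by move: nu2; lra.
have uS := posdefmx_unit Spos; have dS := posdefmx_det_gt0 Spos.
have Q0 : 0 < qform Sigma delta by exact: (proj2 Spos).
have n0 : (0 < n)%N.
  by case: n delta delta0 => [|//] d; rewrite [d]thinmx0 eqxx.
pose p := (nu + n%:R) / 2; pose A := nu^-1 *: invmx Sigma.
have Apos : posdefmx A by apply: posdefmx_invZ; rewrite ?invr_gt0.
pose w := nu *: (delta *m Sigma).
have wA : w *m A = delta.
  by rewrite /w /A -scalemxAr -scalemxAl scalerA mulVf ?gt_eqF// scale1r mulmxK.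
have tE : rdot delta w = tau.
  by rewrite /w rdotZr rdotC.
pose g : R -> R := \1_(`]-oo, (- v)%R]%classic).
have mg : measurable_fun setT g by exact: measurable_indic.
have g0 y : 0 <= g y by rewrite /g indicE.
have p0 : 0 < p by rewrite divr_gt0// ltr_wpDr.
have n1' : 1 <= n%:R :> R by rewrite ler1n.
have Gp : 0 < Gamma p by rewrite Gamma_gt0// /p; have := n1'; move: nu2; lra.
pose C := Gamma p / (Gamma b * Num.sqrt (\det Sigma * (nu * pi) ^+ n)).
have C0 : 0 <= C.
  by apply: divr_ge0; [exact: ltW|apply: mulr_ge0; [exact: ltW|exact: sqrtr_ge0]].
rewrite integral_mkcond.
transitivity (\int[lebesgue_tuple R n]_t (C%:E *
    (g (rdot delta (tvec t)) * student_kernel 1 (- p) A m t)%:E))%E.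
  apply: eq_integral => t _; rewrite patchE /g indicE.
  rewrite (_ : (t \in [set t | rdot delta (tvec t) <= - v]) =
      (rdot delta (tvec t) \in (`]-oo, (- v)%R]%classic : set R))); last first.
    by apply/idP/idP; rewrite !inE/= in_itv/=.
  case: ifPn => _; last by rewrite mul0r mule0.
  by rewrite mul1r -EFinM student_pdf_kernel.
have n1 : n%:R = n.-1%:R + 1 :> R by rewrite natr1 prednK.
rewrite ge0_integralZl//; last 2 first.
- apply/measurable_EFinP; apply: measurable_funM; last exact: measurable_student_kernel.
  by apply: measurableT_comp => //; apply: measurable_rdot => i; exact: measurable_tvec.
- by move=> t _; rewrite lee_fin mulr_ge0// student_kernel_ge0.
rewrite (integral_student_marginal _ Apos delta0 wA)//; last by rewrite /p; move: nu2; lra.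
(* The dimension cancels: (n - 1) / 2 - (nu + n) / 2 = -(nu + 1) / 2. *)
rewrite tE (_ : n.-1%:R / 2 - p = - a); last by rewrite /p /a n1; field.
transitivity (C%:E * ((student_const_n n.-1 p / Num.sqrt (\det A * tau))%:E *
  \int[lebesgue_measure]_(y in `]-oo, (- v)%R]) ((1 + (y - rdot delta m) ^+ 2 / tau) `^ (- a))%:E))%E.
  congr (_ * (_ * _))%E; rewrite [RHS]integral_mkcond; apply: eq_integral => y _.
  by rewrite patchE /g indicE; case: ifPn => _; rewrite ?mul1r ?mul0r.
rewrite (integral_half_line a1 b0 ab tau0 s0) -!EFinM; congr EFin.
rewrite /student_lower_prob mulrA; congr (_ * _).
rewrite /C /student_const_n (_ : p - n.-1%:R / 2 = a); last by rewrite /p /a n1; field.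
have sqrtX x k : 0 <= x -> Num.sqrt (x ^+ k) = Num.sqrt x ^+ k :> R.
  move=> x0; elim: k => [|k IH]; first by rewrite !expr0 sqrtr1.
  by rewrite !exprS sqrtrM// IH.
have pi0 : 0 <= pi :> R by exact: pi_ge0.
(* As det A = 1 / (nu^n det Sigma), the powers of nu and det Sigma cancel against the density's
   constant; of its [n] factors sqrt pi, [student_const_n] cancels all but one. *)
have -> : Num.sqrt (\det A * tau) =
    (Num.sqrt nu ^+ n * Num.sqrt (\det Sigma))^-1 * Num.sqrt tau.
  rewrite /A detZ det_inv exprVn -invfM sqrtrM ?invr_ge0 ?mulr_ge0 ?exprn_ge0 ?ltW//.
  rewrite sqrtrV ?mulr_ge0 ?exprn_ge0 ?ltW// sqrtrM ?exprn_ge0 ?ltW//.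
  by rewrite sqrtX ?ltW.
have -> : Num.sqrt (\det Sigma * (nu * pi) ^+ n) =
    Num.sqrt (\det Sigma) * (Num.sqrt nu ^+ n * Num.sqrt pi ^+ n).
  rewrite sqrtrM ?ltW// exprMn sqrtrM ?exprn_ge0 ?(ltW nu0)//.
  by rewrite !sqrtX ?(ltW nu0).
have -> : Num.sqrt pi ^+ n = Num.sqrt pi ^+ n.-1 * Num.sqrt pi :> R.
  by rewrite -exprSr prednK.
have h1 : Num.sqrt pi != 0 :> R by rewrite gt_eqF// sqrtr_gt0 pi_gt0.
have h2 : Num.sqrt nu ^+ n != 0 by rewrite expf_neq0// gt_eqF// sqrtr_gt0.
have h3 : Num.sqrt pi ^+ n.-1 != 0 :> R by rewrite expf_neq0.
have h4 : Num.sqrt (\det Sigma) != 0 by rewrite gt_eqF// sqrtr_gt0.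
have h5 : Num.sqrt tau != 0 by rewrite gt_eqF// sqrtr_gt0.
have h6 : Gamma p != 0 by exact: lt0r_neq0.
have h7 : Gamma b != 0 by exact: lt0r_neq0.
move: (Num.sqrt nu ^+ n) (Num.sqrt pi ^+ n.-1) (Gamma p) (Gamma b) (Num.sqrt tau) (Num.sqrt (\det Sigma)) h2 h3 h4 h5 h6 h7.
by move=> x2 x3 x6 x7 x5 x4 h2 h3 h4 h5 h6 h7; field; rewrite h1 h2 h3 h4 h5 h6 h7.
Qed.

End student_component.

Lemma linear_portfolio_rdot (R : realType) d (T : measurableType d) (P : probability T R)
    n (delta : 'rV[R]_n) (X : 'I_n -> {RV P >-> R}) (w : T) :
  linear_portfolio delta X w = rdot delta (tvec [tuple X i w | i < n]).
Proof.
rewrite /linear_portfolio /rdot mxE; apply: eq_bigr => i _.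
by rewrite !mxE tnth_mktuple.
Qed.

Lemma measurable_half_space (R : realType) n (delta : 'rV[R]_n) (c : R) :
  measurable [set t : n.-tuple R | rdot delta (tvec t) <= c].
Proof.
have m : measurable_fun [set: n.-tuple R] (fun t => rdot delta (tvec t)).
  by apply: measurable_rdot => i; exact: measurable_tvec.
rewrite (_ : [set t | _] = setT `&` (fun t : n.-tuple R => rdot delta (tvec t)) @^-1` `]-oo, c]%classic).
  exact: m.
by apply/seteqP; split=> [t tc|t [_]]; [split=> //=; rewrite in_itv|rewrite /= in_itv].
Qed.

Lemma student_pdf_ge0 (R : realType) n (nu : R) (m x : 'rV[R]_n) (Sigma : 'M[R]_n) :
  2 < nu -> 0 <= student_pdf nu m Sigma x.
Proof.
move=> nu2; rewrite mulr_ge0 ?powR_ge0// divr_ge0 ?mulr_ge0 ?sqrtr_ge0//.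
  have n0 : 0 <= n%:R :> R by [].
  by rewrite ltW// Gamma_gt0//; lra.
by rewrite ltW// Gamma_gt0//; lra.
Qed.

(** * The portfolio's distribution and Value-at-Risk *)

Section mixture.
Variables (R : realType) (n m : nat) (delta : 'rV[R]_n) (beta nu : 'I_m -> R).
Variables (mu : 'I_m -> 'rV[R]_n) (Sigma : 'I_m -> 'M[R]_n).
Hypotheses (delta_neq0 : delta != 0) (beta_gt0 : forall j, 0 < beta j).
Hypotheses (nu_gt2 : forall j, 2 < nu j) (Sigma_posdef : forall j, posdefmx (Sigma j)).

Lemma mixture_student_tailE v : (forall j, 0 < rdot delta (mu j) + v) ->
  mixture_student_tail delta beta nu mu Sigma v =
  \sum_(j < m) beta j * student_lower_prob (nu j) (mu j) delta (Sigma j) v.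
Proof.
move=> vpos; apply: eq_bigr => j _.
by rewrite student_lower_probE// /= !mulrA.
Qed.

Lemma mixture_student_tail_lt (v v' : R) : (0 < m)%N -> (forall j, 0 < rdot delta (mu j) + v) ->
  v < v' -> mixture_student_tail delta beta nu mu Sigma v' <
            mixture_student_tail delta beta nu mu Sigma v.
Proof.
move=> m0 vpos vv'; rewrite !mixture_student_tailE//; last first.
  by move=> j; apply: lt_trans (vpos j) _; rewrite ltrD2l.
apply: ltr_sum => [|j _]; last by rewrite ltr_pM2l// student_lower_prob_lt.
by apply/hasP; exists (Ordinal m0); rewrite ?mem_index_enum.
Qed.

Lemma portfolio_cdf d (T : measurableType d) (P : probability T R) (X : 'I_n -> {RV P >-> R}) v :
  has_density X (student_mixture_pdf beta nu mu Sigma) ->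
  (forall j, 0 < rdot delta (mu j) + v) ->
  P [set w | linear_portfolio delta X w <= - v] =
  (mixture_student_tail delta beta nu mu Sigma v)%:E.
Proof.
move=> Xh vpos; have mA := measurable_half_space delta (- v).
rewrite (_ : [set w | _] = [set w | [set t | rdot delta (tvec t) <= - v]
    [tuple X i w | i < n]]); last first.
  by apply/seteqP; split=> w /=; rewrite linear_portfolio_rdot.
rewrite Xh// mixture_student_tailE//.
have mpdf j : measurable_fun setT
    (fun t : n.-tuple R => student_pdf (nu j) (mu j) (Sigma j) (tvec t)).
  under eq_fun do rewrite student_pdf_kernel.
  by apply: measurable_funM => //; exact: measurable_student_kernel.
under eq_integral do rewrite /student_mixture_pdf -sumEFin.
rewrite ge0_integral_sum//; last 2 first.
- move=> j; apply/measurable_EFinP; apply: measurable_funTS.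
  by apply: measurable_funM => //; exact: mpdf.
- by move=> j t _; rewrite lee_fin mulr_ge0 ?student_pdf_ge0// ltW.
rewrite -sumEFin; apply: eq_bigr => j _.
under eq_integral do rewrite EFinM.
rewrite ge0_integralZl//; last 3 first.
- by apply/measurable_EFinP; apply: measurable_funTS; exact: mpdf.
- by move=> t _; rewrite lee_fin student_pdf_ge0.
- by rewrite lee_fin ltW.
by rewrite [X in (_ * X)%E]integral_student_pdf// EFinM.
Qed.

End mixture.

Theorem corollary3p1 (R : realType) (d : measure_display)
    (T : measurableType d) (P : probability T R) (n m : nat)
    (X : 'I_n -> {RV P >-> R}) (delta : 'rV[R]_n) (beta nu : 'I_m -> R)
    (mu : 'I_m -> 'rV[R]_n) (Sigma : 'I_m -> 'M[R]_n)
    (delta_neq0 : delta != 0)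
    (beta_gt0 : forall j : 'I_m, 0 < beta j)
    (beta_sum : \sum_(j < m) beta j = 1)
    (nu_gt2 : forall j : 'I_m, 2 < nu j)
    (Sigma_posdef : forall j : 'I_m, posdefmx (Sigma j))
    (X_density : has_density X (student_mixture_pdf beta nu mu Sigma))
    (alpha VaR : R)
    (VaR_pos : forall j : 'I_m, 0 < rdot delta (mu j) + VaR) :
  is_VaR P (linear_portfolio delta X) alpha VaR <->
  alpha = mixture_student_tail delta beta nu mu Sigma VaR /\
  (forall v : R, (forall j : 'I_m, 0 < rdot delta (mu j) + v) ->
     alpha = mixture_student_tail delta beta nu mu Sigma v -> v = VaR).
Proof.
(* An empty mixture, whose tail would be constant, is excluded because the weights sum to 1. *)
have m0 : (0 < m)%N.
  case: m beta beta_sum {beta_gt0 X_density nu mu Sigma nu_gt2 Sigma_posdef VaR_pos} => [|//] b.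
  by rewrite big_ord0 => /esym/eqP; rewrite oner_eq0.
rewrite /is_VaR (portfolio_cdf delta_neq0 beta_gt0 nu_gt2 Sigma_posdef X_density VaR_pos).
split=> [[<-]|[-> _]//]; split=> // v vpos tailE.
have tail_lt := mixture_student_tail_lt delta_neq0 beta_gt0 nu_gt2 Sigma_posdef m0.
have [vV|Vv|//] := ltgtP v VaR.
- by have := tail_lt _ _ _ vpos vV; rewrite tailE ltxx.
- by have := tail_lt _ _ _ VaR_pos Vv; rewrite tailE ltxx.
Qed.
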